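(* Let $G$ be a complex linear algebraic group acting linearly on finite-dimensional complex vector spaces $V$ and $W$, and let $(v,w)\in V\oplus W$ with $v\neq0$ and $w\neq 0$. Then the pair $[v,w]$ is semistable if and only if it is numerically semistable.
   Context: Semistable: $\overline{G.[v,w]}\cap\mathbb{P}(0\oplus W)=\varnothing$, where $[v,w]\in\mathbb{P}(V\oplus W)$ and the closure is taken in $\mathbb{P}(V\oplus W)$. Let $F=\mathbb{C}((z))$. An arc in $G$ is an $F$-point $\rho\in G(F)$. Choosing bases $(x_0,\dots,x_p)$ of $V$ and $(y_0,\dots,y_q)$ of $W$, write $\rho.(v,w)_F=\sum_i a_i x_i+\sum_i b_i y_i$ with $a_i,b_i\in F$, where $(v,w)_F$ is the image of $(v,w)$ in $(V\oplus W)\otimes_{\mathbb{C}}F$. The weight of $\rho$ is $$\nu(\rho,[v,w])=\min_{i:\,b_i\neq0}\mathrm{ord}_0(b_i)-\min_{i:\,a_i\ne0}\mathrm{ord}_0(a_i)\in\mathbb{Z},$$ with $\mathrm{ord}_0$ the order of vanishing at $z=0$ of a Laurent series; this is independent of the choices of bases and of the representative of $[v,w]$. Numerically semistable: $\nu(\rho,[v,w])\ge0$ for all arcs $\rho$ in $G$. *)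

(* Defs.v *)
From HB Require Import structures.
From mathcomp Require Import all_boot all_order all_algebra.
From mathcomp Require Import boolp classical_sets reals complex.
From mathcomp Require Import mpoly.

Set Implicit Arguments.
Unset Strict Implicit.
Unset Printing Implicit Defensive.

Import Order.TTheory GRing.Theory Num.Theory.
Local Open Scope classical_set_scope.
Local Open Scope ring_scope.

(* Formal power series K[[z]], by their coefficient sequences. *)
Record fps (K : fieldType) := Fps { fps_coef : nat -> K }.
Coercion fps_coef : fps >-> Funclass.

Section PowerSeries.
Variable K : fieldType.
Implicit Types (a b c : fps K) (n : nat).

Lemma fpsP a b : a =1 b -> a = b.
Proof. by case: a b => [a] [b] /= /funext->. Qed.

HB.instance Definition _ := gen_eqMixin (fps K).
HB.instance Definition _ := gen_choiceMixin (fps K).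

Definition fps_const (x : K) : fps K := Fps (fun n => if n == 0%N then x else 0).
Definition fps_add a b : fps K := Fps (fun n => a n + b n).
Definition fps_opp a : fps K := Fps (fun n => - a n).
Definition fps_mul a b : fps K :=
  Fps (fun n => \sum_(i < n.+1) a i * b (n - i)%N).

Lemma fps_addA : associative fps_add.
Proof. by move=> a b c; apply: fpsP => n /=; rewrite addrA. Qed.
Lemma fps_addC : commutative fps_add.
Proof. by move=> a b; apply: fpsP => n /=; rewrite addrC. Qed.
Lemma fps_add0 : left_id (fps_const 0) fps_add.
Proof. by move=> a; apply: fpsP => n /=; rewrite if_same add0r. Qed.
Lemma fps_addN : left_inverse (fps_const 0) fps_opp fps_add.
Proof. by move=> a; apply: fpsP => n /=; rewrite if_same addNr. Qed.

HB.instance Definition _ :=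
  GRing.isZmodule.Build (fps K) fps_addA fps_addC fps_add0 fps_addN.

Definition fps_trunc n a : {poly K} := \poly_(i < n.+1) a i.

Lemma fps_mul_trunc n k a b : (k <= n)%N ->
  fps_mul a b k = (fps_trunc n a * fps_trunc n b)`_k.
Proof.
move=> lekn; rewrite coefM; apply: eq_bigr => i _; rewrite !coef_poly !ltnS.
have lein : (i <= n)%N by apply: leq_trans lekn; rewrite -ltnS.
by rewrite lein (leq_trans (leq_subr i k) lekn).
Qed.

Lemma fps_mulC : commutative fps_mul.
Proof.
by move=> a b; apply: fpsP => n; rewrite !(@fps_mul_trunc n) // mulrC.
Qed.

Lemma fps_mulA : associative fps_mul.
Proof.
move=> a b c; apply: fpsP => n.
transitivity (fps_trunc n a * (fps_trunc n b * fps_trunc n c))`_n.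
  rewrite coefM; apply: eq_bigr => i _; rewrite coef_poly ltn_ord.
  by rewrite (@fps_mul_trunc n) ?leq_subr.
rewrite mulrA coefM; apply: eq_bigr => i _; rewrite coef_poly ltnS leq_subr.
by rewrite (@fps_mul_trunc n) // -ltnS.
Qed.

Lemma fps_mul1 : left_id (fps_const 1) fps_mul.
Proof.
move=> a; apply: fpsP => n /=; rewrite big_ord_recl /= mul1r subn0 big1 ?addr0 //.
by move=> i _; rewrite mul0r.
Qed.

Lemma fps_mulDl : left_distributive fps_mul +%R.
Proof.
move=> a b c; apply: fpsP => n /=; rewrite -big_split /=.
by apply: eq_bigr => i _; rewrite mulrDl.
Qed.

Lemma fps_1neq0 : fps_const 1 != 0.
Proof.
by apply/eqP => /(congr1 (fun a : fps K => a 0%N)) /= /eqP; rewrite oner_eq0.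
Qed.

HB.instance Definition _ := GRing.Zmodule_isComNzRing.Build (fps K)
  fps_mulA fps_mulC fps_mul1 fps_mulDl fps_1neq0.

Lemma fps_coef0 n : (0 : fps K) n = 0.
Proof. by rewrite /= if_same. Qed.

Lemma fps_const_is_zmod_morphism : zmod_morphism fps_const.
Proof.
by move=> x y; apply: fpsP => n /=; case: ifP => _; rewrite ?subr0.
Qed.

Lemma fps_const_is_monoid_morphism : monoid_morphism fps_const.
Proof.
split=> // x y; apply: fpsP => n /=; rewrite big_ord_recl /= subn0 big1 ?addr0.
  by case: ifP => _; rewrite ?mulr0.
by move=> i _; rewrite mul0r.
Qed.

HB.instance Definition _ := GRing.isZmodMorphism.Build K (fps K) fps_const
  fps_const_is_zmod_morphism.
HB.instance Definition _ := GRing.isMonoidMorphism.Build K (fps K) fps_const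
  fps_const_is_monoid_morphism.

Definition fps_unit : pred (fps K) := fun a => `[< exists b, b * a = 1 >].
Definition fps_inv a : fps K := if fps_unit a then xget a [set b | b * a = 1] else a.

Lemma fps_mulV : {in fps_unit, left_inverse 1 fps_inv *%R}.
Proof.
move=> a; rewrite /in_mem /= /fps_inv => ua; rewrite ua.
have [b ba1] := asboolW ua; exact: (@xgetI _ a [set b | b * a = 1] b ba1).
Qed.

Lemma fps_unitP a b : b * a = 1 -> fps_unit a.
Proof. by move=> ba1; apply/asboolP; exists b. Qed.

Lemma fps_inv_out : {in [predC fps_unit], fps_inv =1 id}.
Proof. by move=> a /negPf; rewrite /in_mem /= /fps_inv => ->. Qed.

HB.instance Definition _ := GRing.ComNzRing_hasMulInverse.Build (fps K)
  fps_mulV fps_unitP fps_inv_out.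

(* The order of vanishing at z = 0; the value at the zero series is junk. *)
Definition fps_ord a : nat :=
  if pselect (exists n, a n != 0) is left ex_n then ex_minn ex_n else 0%N.

Lemma fps_ordP a : a != 0 ->
  a (fps_ord a) != 0 /\ forall n, (n < fps_ord a)%N -> a n = 0.
Proof.
rewrite /fps_ord; case: pselect => [ex_n|nex] a_neq0.
  case: ex_minnP => m am_neq0 m_min; split=> // n.
  by apply: contraTeq => /m_min; rewrite -leqNgt.
case/eqP: a_neq0; apply: fpsP => n; rewrite fps_coef0; apply/eqP.
by apply: contra_notT nex => an_neq0; exists n.
Qed.

Lemma fps_ord_unique a m :
  a m != 0 -> (forall n, (n < m)%N -> a n = 0) -> fps_ord a = m.
Proof.
move=> am_neq0 a_lt0.
have a_neq0 : a != 0.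
  by apply: contraNneq am_neq0 => ->; rewrite fps_coef0.
have [ao_neq0 ao_lt0] := fps_ordP a_neq0.
apply/eqP; rewrite eqn_leq; apply/andP; split; rewrite leqNgt.
  by apply: contra am_neq0 => /ao_lt0 ->.
by apply: contra ao_neq0 => /a_lt0 ->.
Qed.

Let coef_mul_ord a b : a != 0 -> b != 0 ->
  (a * b) (fps_ord a + fps_ord b)%N = a (fps_ord a) * b (fps_ord b) /\
  forall n, (n < fps_ord a + fps_ord b)%N -> (a * b) n = 0.
Proof.
move=> /fps_ordP[_ a0] /fps_ordP[_ b0]; split=> [|n ltn] /=.
  have lt_a : (fps_ord a < (fps_ord a + fps_ord b).+1)%N by rewrite ltnS leq_addr.
  rewrite (bigD1 (Ordinal lt_a)) //= addKn big1 ?addr0 // => i.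
  rewrite -val_eqE /= neq_ltn => /orP[/a0->|lti]; first by rewrite mul0r.
  have lei : (i <= fps_ord a + fps_ord b)%N by rewrite -ltnS.
  by rewrite b0 ?mulr0 // ltn_subLR // ltn_add2r.
apply: big1 => i _; have [/a0->|lei] := ltnP i (fps_ord a); first by rewrite mul0r.
have le_in : (i <= n)%N by rewrite -ltnS.
by rewrite b0 ?mulr0 // ltn_subLR // (leq_trans ltn) // leq_add2r.
Qed.

Lemma fps_ordM a b : a != 0 -> b != 0 ->
  fps_ord (a * b) = (fps_ord a + fps_ord b)%N.
Proof.
move=> a0 b0; have [eq_ab lt_ab] := coef_mul_ord a0 b0.
apply: fps_ord_unique => //; rewrite eq_ab mulf_neq0 //.
  by have [] := fps_ordP a0.
by have [] := fps_ordP b0.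
Qed.

Lemma fps_integral a b : a * b = 0 -> (a == 0) || (b == 0).
Proof.
move=> ab0; apply: contra_eqT ab0; rewrite negb_or => /andP[a0 b0].
have [eq_ab _] := coef_mul_ord a0 b0; apply/eqP => ab0.
have /eqP := eq_ab; rewrite ab0 fps_coef0 eq_sym mulf_eq0.
have [/negPf-> _] := fps_ordP a0.
by have [/negPf-> _] := fps_ordP b0.
Qed.

HB.instance Definition _ :=
  GRing.ComUnitRing_isIntegral.Build (fps K) fps_integral.

End PowerSeries.

(* K((z)) is the fraction field of K[[z]]; the order at 0 of a Laurent series
   a / b is ord a - ord b (laurent_ord_frac). *)
Notation laurent K := {fraction (fps K)}.

Section LaurentSeries.
Variable K : fieldType.

Definition laurent_const : K -> laurent K :=
  @FracField.tofrac (fps K) \o @fps_const K.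

HB.instance Definition _ := GRing.RMorphism.on laurent_const.

Definition laurent_ord (f : laurent K) : int :=
  (fps_ord \n_(repr f))%:Z - (fps_ord \d_(repr f))%:Z.

Lemma laurent_ord_frac (a b : fps K) : a != 0 -> b != 0 ->
  laurent_ord (FracField.tofrac a / FracField.tofrac b) =
  (fps_ord a)%:Z - (fps_ord b)%:Z.
Proof.
move=> a0 b0; rewrite /laurent_ord.
set f := _ / _; set n := \n_(repr f); set d := \d_(repr f).
have d0 : d != 0 := denom_ratioP _.
have f_nd : f = FracField.tofrac n / FracField.tofrac d.
  suff <- : f * FracField.tofrac d = FracField.tofrac n.
    by rewrite mulfK ?tofrac_eq0.
  rewrite -[f in LHS]reprK; unlock FracField.tofrac.
  rewrite -[LHS]FracField.pi_mul; apply/eqmodP.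
  rewrite /= FracField.equivfE /FracField.mulf !numden_Ratio ?oner_neq0 ?mulr1 //.
  by rewrite mulrC.
have /eqP : f * (FracField.tofrac b * FracField.tofrac d) =
            FracField.tofrac n * FracField.tofrac b.
  by rewrite f_nd mulrCA mulfVK ?tofrac_eq0 // mulrC.
rewrite /f mulrA mulfVK ?tofrac_eq0 // -!tofracM tofrac_eq => /eqP ad_nb.
have n0 : n != 0.
  have := mulf_neq0 a0 d0; rewrite ad_nb mulf_eq0 negb_or.
  by case/andP.
have := congr1 (@fps_ord K) ad_nb; rewrite !fps_ordM // => e.
by apply/eqP; rewrite subr_eq addrAC eq_sym subr_eq -!PoszD e.
Qed.

(* The value 0 is junk, for a family that is identically zero. *)
Definition min_ord (m : nat) (c : 'I_m -> laurent K) : int :=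
  if [pick i | c i != 0] is Some i0 then
    \big[Num.min/laurent_ord (c i0)]_(i | c i != 0) laurent_ord (c i)
  else 0.

Lemma min_ordP m (c : 'I_m -> laurent K) i0 : c i0 != 0 ->
  (exists2 i, c i != 0 & min_ord c = laurent_ord (c i)) /\
  forall i, c i != 0 -> min_ord c <= laurent_ord (c i).
Proof.
rewrite /min_ord => ci0; case: pickP => [j cj|/(_ i0)]; last by rewrite ci0.
split=> [|i ci]; last exact: bigmin_le_cond.
elim/big_ind: _ => [|x y [i ci ->] [k ck ->]|i ci]; first by exists j.
  by rewrite minEle; case: ifP => _; [exists i | exists k].
by exists i.
Qed.

End LaurentSeries.

(* The coordinate ring of GL_n is generated by the n^2 matrix entries and
   1 / det, so its elements are represented by polynomials in n^2 + 1
   variables evaluated at gl_coord. *)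
Definition gl_coord (K : fieldType) (n : nat) (g : 'M[K]_n) :
    'I_(n * n + 1) -> K :=
  fun i => row_mx (mxvec g) (\det g)^-1%:M 0 i.

(* Zariski closed subgroups of GL_n, identified with their sets of C-points. *)
Record linear_algebraic_group (C : closedFieldType) (n : nat) := LinAlgGroup {
  lag_set :> 'M[C]_n -> Prop;
  lag_closed : exists S : set {mpoly C[n * n + 1]},
    lag_set = [set g | g \in unitmx /\ forall p, S p -> p.@[gl_coord g] = 0];
  lag1 : lag_set 1%:M;
  lagM : forall g h, lag_set g -> lag_set h -> lag_set (g *m h);
  lagV : forall g, lag_set g -> lag_set (invmx g)
}.

Section AlgebraicGroups.
Variables (C : closedFieldType) (n : nat) (G : linear_algebraic_group C n).

Definition represents (f : 'M[C]_n -> C) (p : {mpoly C[n * n + 1]}) : Prop :=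
  forall g, G g -> f g = p.@[gl_coord g].

Definition regular (f : 'M[C]_n -> C) : Prop := exists p, represents f p.

(* G(F) for F = C((z)): the F-points of GL_n annihilated by the ideal of G. *)
Definition arc : set 'M[laurent C]_n :=
  [set rho | rho \in unitmx /\
    forall p : {mpoly C[n * n + 1]}, (forall g, G g -> p.@[gl_coord g] = 0) ->
      (map_mpoly (@laurent_const C) p).@[gl_coord rho] = 0].

(* The image of a regular function under the morphism C[G] -> F given by an
   F-point of G. *)
Definition arc_eval (f : 'M[C]_n -> C) (rho : 'M[laurent C]_n) : laurent C :=
  (map_mpoly (@laurent_const C) (xget 0 [set p | represents f p])).@[gl_coord rho].

Lemma arc_evalE f p rho : represents f p -> arc rho ->
  arc_eval f rho = (map_mpoly (@laurent_const C) p).@[gl_coord rho].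
Proof.
move=> fp [_ rho0]; rewrite /arc_eval; set q := xget _ _.
have fq : represents f q by apply: (@xgetI _ 0 [set r | represents f r] p fp).
apply/eqP; rewrite -subr_eq0 -mevalB -rmorphB; apply/eqP; apply: rho0 => g Gg.
by rewrite mevalB -fp // -fq // subrr.
Qed.

(* Rational representations: the matrix coefficients are regular functions.
   The action is only meaningful on G; its values elsewhere are junk. *)
Record algebraic_rep (V : vectType C) := AlgebraicRep {
  rep_act :> 'M[C]_n -> 'End(V);
  rep_act1 : rep_act 1%:M = \1%VF;
  rep_actM : forall g h, G g -> G h ->
    rep_act (g *m h) = (rep_act g \o rep_act h)%VF;
  rep_regular : forall (l : 'Hom(V, C^o)) (x : V),
    regular (fun g => l (rep_act g x))
}.

End AlgebraicGroups.

Section ProjectiveSpace.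
Variables (C : closedFieldType) (U : vectType C).

(* The points of P(U) are the lines of U; closed sets are the zero loci of sets
   of homogeneous polynomials, in the coordinates given by a fixed basis. *)
Record proj := Proj { line : {vspace U}; dim_line : \dim line = 1%N }.

Definition vcoord (u : U) : 'I_(\dim {:U}) -> C :=
  fun i => coord (vbasis {:U}) i u.

Definition proj_zeros (S : set {mpoly C[\dim {:U}]}) : set proj :=
  [set L | forall p, S p -> forall u, u \in line L -> p.@[vcoord u] = 0].

Definition proj_closed (Z : set proj) : Prop :=
  exists2 S : set {mpoly C[\dim {:U}]},
    (forall p, S p -> exists d : nat, p \is d.-homog) & Z = proj_zeros S.

Definition proj_closure (A : set proj) : set proj :=
  [set L | forall Z, proj_closed Z -> A `<=` Z -> Z L].

End ProjectiveSpace.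

Section Pairs.
Variables (C : closedFieldType) (n : nat) (G : linear_algebraic_group C n).
Variables (V W : vectType C) (rV : algebraic_rep G V) (rW : algebraic_rep G W).

Definition pair_orbit (v : V) (w : W) : set (proj (V * W)%type) :=
  [set L | exists2 g, G g & line L = <[(rV g v, rW g w)]>%VS].

(* P(0 (+) W) *)
Definition proj_snd : set (proj (V * W)%type) :=
  [set L | forall u, u \in line L -> u.1 = 0].

Definition semistable (v : V) (w : W) : Prop :=
  proj_closure (pair_orbit v w) `&` proj_snd = set0.

Variables (p q : nat) (X : p.-tuple V) (Y : q.-tuple W).

(* The scalars coord Y i (rW g w) are the b_i of the orbit map on C-points; being
   regular on G, they are evaluated at F-points of G by arc_eval, and likewise
   for the a_i. *)
Definition arc_weight (rho : 'M[laurent C]_n) (v : V) (w : W) : int :=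
  min_ord (fun i => arc_eval G (fun g => coord Y i (rW g w)) rho)
  - min_ord (fun i => arc_eval G (fun g => coord X i (rV g v)) rho).

Definition numerically_semistable (v : V) (w : W) : Prop :=
  forall rho, arc G rho -> 0 <= arc_weight rho v w.

End Pairs.

(* Main.v *)
(* The limit of an arc of negative weight is a point of P(0 (+) W) in the closure
   of the orbit.

   Conversely, let [0, w0] lie in the closure of the orbit.  The group, the matrix
   coefficients and w0 are defined over a countable subfield F of C.  As C is
   uncountable, some g in G is generic: no homogeneous polynomial over F that is
   nonzero at (0, w0) vanishes at (g v, g w).  Hence, for x = (a_i / b_0) evaluated
   at g, polynomials over F vanishing at x have no constant term.  By Noether
   normalization the x_i are integral over F[y], where the y_i are algebraically
   independent linear forms in x.  Sending y_i to y_i z embeds F(y) into C((z)).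
   By Puiseux's theorem and the uncountability of C, this extends to the
   coordinates of g after a substitution z -> z^m, which defines an arc.  The
   minimal polynomial over F(y) of a general combination of the x_i has
   coefficients in F[y] and its constant term vanishes at y = 0; so it has a root
   of positive order, and extending the embedding by this root makes all x_i of
   positive order, that is, the weight of the arc negative. *)

(* An arc has to kill the whole ideal of the group over C, while the construction yields only an
   isomorphism over F between a subfield of C and one of C((z)). This is enough because the ideal is
   spanned over C by polynomials with coefficients in F: their vanishing at g carries over to the
   image of g, and linearity does the rest.

   Dividing by b_0 turns negative weight into the requirement that all x_i have positive order. The
   embedding of F(y) has several extensions to F(x), one for each branch over y = 0, and in most of
   them some x_i has a non-zero constant term; the difficulty is to make all these constant terms
   vanish at once. As the x_i are integral over F[y], each constant term is a root of a fixed
   specialised equation, so only finitely many families of constant terms are possible. A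
   combination of the x_i whose coefficients are powers of a suitable integer tells the zero family
   from all others, and the control of that single element is a statement about one minimal
   polynomial. *)
From HB Require Import structures.
Require Import Defs.
From mathcomp Require Import all_boot all_order all_algebra.
From mathcomp Require Import boolp classical_sets reals complex mpoly.
From mathcomp Require Import ring lra zify.

Set Implicit Arguments.
Unset Strict Implicit.
Unset Printing Implicit Defensive.

Import Order.TTheory GRing.Theory Num.Theory.
Local Open Scope ring_scope.

(** * Power series *)

(** Strong recursion on a history list: inverses and Hensel lifts compute each coefficient from all
    the earlier ones. *)
Lemma course_of_values (T : Type) (Phi : seq T -> T) :
  exists f : nat -> T, forall n, f n = Phi (mkseq f n).
Proof.
pose g := fix g n := if n is n'.+1 then rcons (g n') (Phi (g n')) else [::].
exists (fun n => Phi (g n)) => n; congr Phi.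
by elim: n => //= n IHn; rewrite mkseqS -IHn.
Qed.

Section PowerSeriesTheory.
Variable K : fieldType.
Implicit Types (a b : fps K) (n k m : nat).

Lemma fps_coefD a b n : (a + b) n = a n + b n. Proof. by []. Qed.
Lemma fps_coefB a b n : (a - b) n = a n - b n. Proof. by []. Qed.
Lemma fps_coefM a b n : (a * b) n = \sum_(i < n.+1) a i * b (n - i)%N.
Proof. by []. Qed.

Lemma fps_coef_sum (I : Type) (r : seq I) (P : pred I) (F : I -> fps K) n :
  (\sum_(i <- r | P i) F i) n = \sum_(i <- r | P i) F i n.
Proof.
apply: (big_morph (fun a : fps K => a n)) => [a b|]; first exact: fps_coefD.
exact: fps_coef0.
Qed.

Definition fps_ct a : K := a 0%N.

Lemma fps_ct_is_zmod_morphism : zmod_morphism fps_ct.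
Proof. by []. Qed.

Lemma fps_ct_is_monoid_morphism : monoid_morphism fps_ct.
Proof.
split=> // a b; rewrite /fps_ct fps_coefM big_ord_recl big_ord0 addr0.
by rewrite subnn.
Qed.

HB.instance Definition _ := GRing.isZmodMorphism.Build (fps K) K fps_ct
  fps_ct_is_zmod_morphism.
HB.instance Definition _ := GRing.isMonoidMorphism.Build (fps K) K fps_ct
  fps_ct_is_monoid_morphism.

Lemma fps_unit_ct a : fps_ct a != 0 -> a \is a GRing.unit.
Proof.
rewrite /fps_ct => a0.
have [f fE] := course_of_values (fun s => if size s == 0%N then (a 0%N)^-1 else
  - (a 0%N)^-1 * \sum_(i < size s) a i.+1 * s`_(size s - i.+1)).
apply/unitrPr; exists (Fps f); apply: fpsP => n; rewrite fps_coefM.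
case: n => [|n].
  by rewrite big_ord_recl big_ord0 addr0 /= fE /= divff.
rewrite big_ord_recl subn0 -[Fps f n.+1]/(f n.+1) fE size_mkseq.
rewrite mulNr mulrN mulVKf //; apply/eqP; rewrite addrC subr_eq0; apply/eqP.
apply: eq_bigr => i _; congr (_ * _).
by rewrite nth_mkseq // ltnS subSS leq_subr.
Qed.

Definition fps_z : fps K := Fps (fun n => (n == 1%N)%:R).

Lemma fps_coef_zXM k a n :
  (fps_z ^+ k * a) n = if (k <= n)%N then a (n - k)%N else 0.
Proof.
elim: k n => [|k IHk] n; first by rewrite mul1r subn0.
rewrite exprS -mulrA fps_coefM; case: n => [|n].
  by rewrite big_ord_recl big_ord0 /= mul0r addr0.
rewrite 2!big_ord_recl big1 => [|i _]; last by rewrite [fps_z _]/= mul0r.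
rewrite [fps_z ord0]/= [fps_z (lift _ _)]/= mul0r mul1r add0r addr0 IHk.
by rewrite lift0 subSS subn0.
Qed.

Lemma fps_zX_neq0 k : fps_z ^+ k != 0.
Proof.
apply/eqP => /(congr1 (fun a : fps K => (a * 1) k)).
rewrite fps_coef_zXM leqnn subnn mul0r fps_coef0 /= => /eqP.
by rewrite oner_eq0.
Qed.

Lemma fps_ct_z : fps_ct fps_z = 0.
Proof. by []. Qed.

Lemma fps_dvdzX k a : (forall n, (n < k)%N -> a n = 0) ->
  a = fps_z ^+ k * Fps (fun n => a (n + k)%N).
Proof.
move=> a0; apply: fpsP => n; rewrite fps_coef_zXM.
by case: leqP => [lekn|/a0//] /=; rewrite subnK.
Qed.

Lemma fps_factor a : a != 0 ->
  exists2 u, fps_ct u != 0 & a = fps_z ^+ fps_ord a * u.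
Proof.
move=> /fps_ordP[a0 alt]; exists (Fps (fun n => a (n + fps_ord a)%N)) => //.
exact: fps_dvdzX.
Qed.

(** The ramification [z |-> z ^ m]. At [m = 0] it keeps only the constant term, so it is a ring
    morphism for every [m]. *)
Definition fps_expand m a : fps K :=
  Fps (fun n => if (m %| n)%N then a (n %/ m)%N else 0).

Lemma fps_expand_is_zmod_morphism m : zmod_morphism (fps_expand m).
Proof.
move=> a b; apply: fpsP => n; rewrite fps_coefB /=.
by case: ifP; rewrite ?subr0.
Qed.

Lemma fps_expand_is_monoid_morphism m : monoid_morphism (fps_expand m).
Proof.
split=> [|a b]; apply: fpsP => n.
  rewrite /=; case: m n => [|m] [|n] //=; case: ifP => // /dvdnP [[|k] nE] //.
  by rewrite nE mulnK.
case: m => [|m].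
  rewrite fps_coefM /= divn0 dvd0n; case: eqP => [->|/eqP n0].
    by rewrite !big_ord_recl !big_ord0.
  rewrite big1 // => i _; rewrite dvd0n; case: eqP => [->|]; last by rewrite mul0r.
  by rewrite subn0 dvd0n (negPf n0) mulr0.
pose A := fps_trunc n a \Po 'X^(m.+1); pose B := fps_trunc n b \Po 'X^(m.+1).
have tr c i : (i <= n)%N -> fps_expand m.+1 c i = (fps_trunc n c \Po 'X^(m.+1))`_i.
  move=> lein; rewrite coef_comp_poly_Xn //=; case: ifP => // _.
  by rewrite coef_poly ltnS (leq_trans (leq_div _ _) lein).
transitivity (A * B)`_n; last first.
  rewrite coefM fps_coefM; apply: eq_bigr => i _.
  by rewrite !tr ?leq_subr // -ltnS.
rewrite -comp_polyM coef_comp_poly_Xn //=; case: ifP => // _.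
by rewrite -fps_mul_trunc // leq_div.
Qed.

HB.instance Definition _ m := GRing.isZmodMorphism.Build (fps K) (fps K)
  (fps_expand m) (fps_expand_is_zmod_morphism m).
HB.instance Definition _ m := GRing.isMonoidMorphism.Build (fps K) (fps K)
  (fps_expand m) (fps_expand_is_monoid_morphism m).

Lemma fps_expand_inj m : (0 < m)%N -> injective (fps_expand m).
Proof.
move=> m0 a b /(congr1 (@fps_coef K)) eq_ab; apply: fpsP => n.
by have := congr1 (@^~ (n * m)%N) eq_ab; rewrite /= dvdn_mull // mulnK.
Qed.

Lemma fps_expand_comp m k a : (0 < m)%N -> (0 < k)%N ->
  fps_expand k (fps_expand m a) = fps_expand (m * k)%N a.
Proof.
move=> m0 k0; apply: fpsP => n /=; case: (boolP (k %| n)%N) => [/dvdnP[q ->]|nkn].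
  rewrite mulnK // dvdn_pmul2r //; case: ifP => // mq.
  by rewrite divnMr.
case: ifP => // /dvdnP[q nE]; case/negP: nkn; rewrite nE mulnA dvdn_mull //.
Qed.

Lemma fps_expand_const m x : (0 < m)%N -> fps_expand m (fps_const x) = fps_const x.
Proof.
move=> m0; apply: fpsP => n /=; case: ifP => [/dvdnP[k ->]|].
  by rewrite mulnK // muln_eq0 [m == 0%N]gtn_eqF // orbF.
by case: n => //=; rewrite dvdn0.
Qed.

Lemma fps_ct_expand m a : fps_ct (fps_expand m a) = fps_ct a.
Proof. by rewrite /fps_ct /= dvdn0 div0n. Qed.

End PowerSeriesTheory.

(** * Hensel's lemma and Puiseux's theorem *)

Section Hensel.
Variable K : fieldType.
Implicit Types (A B e : {poly K}) (P Q : {poly fps K}).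

Lemma coprime_decomposition A B e :
    A \is monic -> B \is monic -> coprimep A B -> (size e < size (A * B)%R)%N ->
  exists ab : {poly K} * {poly K}, [/\ (size ab.1 < size A)%N,
    (size ab.2 < size B)%N & ab.1 * B + A * ab.2 = e].
Proof.
move=> mA mB /Bezout_eq1_coprimepP[[u v] /= uv1] sz_e.
have A0 := monic_neq0 mA; have B0 := monic_neq0 mB.
pose al := (e * v) %% A; pose be := e * u + ((e * v) %/ A) * B.
have sz_al : (size al < size A)%N by rewrite ltn_modp.
have albe : al * B + A * be = e.
  have evE := divp_eq (e * v) A.
  transitivity (A * (e * u) + (((e * v) %/ A) * A + al) * B).
    by rewrite /be; ring.
  by rewrite -evE -[RHS]mulr1 -uv1; ring.
exists (al, be); split => //=.
have [->|be0] := eqVneq be 0; first by rewrite size_poly0 size_poly_gt0.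
have : (size (A * be)%R < size (A * B)%R)%N.
  have -> : A * be = e - al * B by rewrite -albe addrC addKr.
  apply: leq_ltn_trans (size_polyD _ _) _; rewrite size_polyN gtn_max sz_e /=.
  have [->|al0] := eqVneq al 0; first by rewrite mul0r size_poly0 size_poly_gt0 mulf_neq0.
  rewrite !size_mul //.
  have sB : (0 < size B)%N by rewrite size_poly_gt0.
  by rewrite -(prednK sB) !addnS /= ltn_add2r.
have sA : (0 < size A)%N by rewrite size_poly_gt0.
by rewrite !size_mul // -(prednK sA) !addSn /= ltn_add2l.
Qed.

(** The coefficients of [z ^ n] in the two factors are found one after the other. Each correction
    has smaller degree than the factor that it corrects, which keeps [A'] monic of the degree of
    [A]. *)
Lemma hensel Q A B :
    Q \is monic -> A \is monic -> B \is monic -> coprimep A B ->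
    map_poly (@fps_ct K) Q = A * B ->
  exists A' B' : {poly fps K}, [/\ A' \is monic, size A' = size A,
    map_poly (@fps_ct K) A' = A & Q = A' * B'].
Proof.
move=> mQ mA mB coAB QE.
have A0 := monic_neq0 mA; have B0 := monic_neq0 mB.
have szAB : size (A * B) = (size A + size B).-1 by rewrite size_mul.
have szQ : size Q = size (A * B).
  by rewrite -QE size_map_poly_id0 // (monicP mQ) rmorph1 oner_neq0.
(* [Q] is read as a power series in [z] with polynomial coefficients; as [Q] is monic, only [q 0]
   reaches the full degree. *)
pose q n : {poly K} := \poly_(i < size Q) Q`_i n.
have qE n k : (q n)`_k = Q`_k n.
  rewrite coef_poly; case: ltnP => // ?.
  by rewrite nth_default // fps_coef0.
have q0 : q 0%N = A * B by apply/polyP => k; rewrite qE -QE coef_map.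
have szq n : (size (q n.+1) < size (A * B)%R)%N.
  rewrite -szQ; have: (size (q n.+1) <= size Q)%N by apply: size_poly.
  rewrite leq_eqVlt => /orP[/eqP eqsz|//].
  have: lead_coef (q n.+1) != 0.
    by rewrite lead_coef_eq0 -size_poly_eq0 eqsz size_poly_eq0 monic_neq0.
  by rewrite lead_coefE qE eqsz -lead_coefE (monicP mQ) eqxx.
have /choice[sol solP] e : exists ab : {poly K} * {poly K},
    (size e < size (A * B)%R)%N -> [/\ (size ab.1 < size A)%N,
    (size ab.2 < size B)%N & ab.1 * B + A * ab.2 = e].
  case: (boolP (size e < size (A * B)%R)%N) => [lt|]; last by exists (0, 0).
  by have [ab abP] := coprime_decomposition mA mB coAB lt; exists ab.
(* What the two terms with the unknown [f n.+1], multiplied by [A] and [B], must contribute to the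
   coefficient of [z ^ n.+1]. *)
pose rest (f : nat -> {poly K} * {poly K}) n :=
  q n.+1 - \sum_(i < n) (f i.+1).1 * (f (n - i)%N).2.
have [f fE] := course_of_values (fun s => if size s is n.+1 then
  sol (rest (nth 0 s) n) else (A, B)).
have f0 : f 0%N = (A, B) by rewrite fE.
have fS n : f n.+1 = sol (rest f n).
  rewrite fE size_mkseq; congr (sol (_ - _)); apply: eq_bigr => i _.
  have lti := ltn_ord i.
  by rewrite !nth_mkseq // ltnS // leq_subr.
have inv n : [/\ (size (f n.+1).1 < size A)%N, (size (f n.+1).2 < size B)%N &
    (f n.+1).1 * B + A * (f n.+1).2 = rest f n].
  elim/ltn_ind: n => n IHn; rewrite fS; apply: solP.
  apply: leq_ltn_trans (size_polyD _ _) _; rewrite size_polyN gtn_max szq /=.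
  apply: leq_ltn_trans (size_sum _ _ _) _.
  have szAB0 : (0 < size (A * B)%R)%N by rewrite size_poly_gt0 mulf_neq0.
  rewrite -(prednK szAB0) ltnS; apply/bigmax_leqP => i _.
  have [lt1 _ _] := IHn i (ltn_ord i).
  have ni : (n - i = (n - i.+1).+1)%N by rewrite subnSK.
  have [_ lt2 _] : [/\ (size (f (n - i)%N).1 < size A)%N,
      (size (f (n - i)%N).2 < size B)%N & True].
    rewrite ni; have [] := IHn (n - i.+1)%N => //.
    by have := ltn_ord i; lia.
  apply: leq_trans (size_polyMleq _ _) _; rewrite szAB.
  by move: lt1 lt2; lia.
have conv n : \sum_(j < n.+1) (f j).1 * (f (n - j)%N).2 = q n.
  case: n => [|n]; first by rewrite big_ord_recl big_ord0 addr0 /= f0 q0.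
  have [_ _] := inv n; rewrite /rest => /eqP; rewrite eq_sym subr_eq => /eqP ->.
  rewrite big_ord_recl subn0 big_ord_recr subnn /= f0 /= addrA addrAC -addrA.
  rewrite addrCA -addrA /bump /= add1n.
  by under eq_bigr => i _ do rewrite add1n subSS.
pose lft (g : nat -> {poly K}) s : {poly fps K} :=
  \poly_(i < s) Fps (fun n => (g n)`_i).
have lftE (g : nat -> {poly K}) s k : (forall n, size (g n) <= s)%N ->
    (lft g s)`_k = Fps (fun n => (g n)`_k).
  move=> szg; rewrite coef_poly; case: ltnP => // lesk.
  by apply: fpsP => n; rewrite fps_coef0 /= nth_default // (leq_trans (szg n)).
have lft_monic (g : nat -> {poly K}) : g 0%N \is monic ->
    (forall n, size (g n.+1) < size (g 0%N))%N ->
    lft g (size (g 0%N)) \is monic /\ size (lft g (size (g 0%N))) = size (g 0%N).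
  move=> mg0 szg; have sg0 : (0 < size (g 0%N))%N.
    by rewrite size_poly_gt0 monic_neq0.
  have cf : (lft g (size (g 0%N)))`_(size (g 0%N)).-1 = 1.
    rewrite lftE => [|[|n]] //; last by rewrite ltnW.
    apply: fpsP => -[|n] /=; first by rewrite -lead_coefE (monicP mg0).
    by rewrite nth_default // -ltnS prednK.
  have szl : size (lft g (size (g 0%N))) = size (g 0%N).
    apply/eqP; rewrite eqn_leq size_poly /= leqNgt; apply/negP => lt.
    have := cf; rewrite nth_default => [/eqP|]; first by rewrite eq_sym oner_eq0.
    by rewrite -ltnS prednK.
  by split=> //; apply/monicP; rewrite lead_coefE szl.
have [mA' szA'] : lft (fun n => (f n).1) (size A) \is monic /\
    size (lft (fun n => (f n).1) (size A)) = size A.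
  have := lft_monic (fun n => (f n).1); rewrite f0; apply=> // n.
  by have [] := inv n.
exists (lft (fun n => (f n).1) (size A)), (lft (fun n => (f n).2) (size B)).
split=> //.
  apply/polyP => k; rewrite coef_map lftE; first by rewrite /fps_ct /= f0.
  by case=> [|m]; rewrite ?f0 //; apply: ltnW; have [] := inv m.
apply/polyP => k; apply: fpsP => n; rewrite -qE -conv coef_sum.
under eq_bigr do rewrite coefM.
rewrite exchange_big /= coefM fps_coef_sum; apply: eq_bigr => i _.
rewrite fps_coefM; apply: eq_bigr => j _; rewrite !lftE //.
  by case=> [|m]; rewrite ?f0 //; apply: ltnW; have [] := inv m.
by case=> [|m]; rewrite ?f0 //; apply: ltnW; have [] := inv m.
Qed.

End Hensel.

(** Rescaling of the variable by [w]; it serves both for the slope of a Newton polygon and for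
    clearing denominators. *)
Lemma horner_scaled (R : comNzRingType) (P Q : {poly R}) (w x : R) d :
  (size P <= d.+1)%N -> (size Q <= d.+1)%N ->
  (forall l, (l <= d)%N -> P`_l = w ^+ (d - l) * Q`_l) ->
  P.[w * x] = w ^+ d * Q.[x].
Proof.
move=> szP szQ PQ; rewrite (horner_coef_wide _ szP) (horner_coef_wide _ szQ).
rewrite mulr_sumr; apply: eq_bigr => l _; have lel : (l <= d)%N by rewrite -ltnS.
have -> : w ^+ d = w ^+ (d - l) * w ^+ l by rewrite -exprD subnK.
by rewrite PQ // exprMn; ring.
Qed.

Lemma coef_XsubC_exp (R : comNzRingType) (c : R) n :
  (('X - c%:P) ^+ n.+1)`_n = - c *+ n.+1.
Proof.
elim: n => [|n IHn]; first by rewrite expr1 coefB coefX coefC sub0r.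
rewrite exprS mulrBl coefB coefXM coefCM IHn /=.
have -> : (('X - c%:P) ^+ n.+1)`_n.+1 = 1.
  have /monicP := monic_exp n.+1 (monicXsubC c).
  by rewrite lead_coefE size_exp_XsubC.
by rewrite mulr1 -mulrSr.
Qed.

Section Puiseux.
Variable C : numClosedFieldType.
Implicit Types (P Q : {poly fps C}).

(** The shift is by [P_d / (d + 1)], in characteristic zero. Without a term of degree [d], the
    reduction of a rescaled polynomial can be a power of [X - r] only for [r = 0]. *)
Lemma tschirnhaus P d : P \is monic -> size P = d.+2 ->
  exists c, [/\ P \Po ('X - c%:P) \is monic, size (P \Po ('X - c%:P)) = d.+2 &
    (P \Po ('X - c%:P))`_d = 0].
Proof.
move=> mP szP; pose c := P`_d * fps_const (d.+1%:R^-1); exists c.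
have szX : size ('X - c%:P) = 2%N by rewrite size_XsubC.
have szPc : size (P \Po ('X - c%:P)) = d.+2 by rewrite size_comp_poly2.
have mP1 : P`_d.+1 = 1 by have /monicP := mP; rewrite lead_coefE szP.
have PE : P = 'X^(d.+1) + P`_d *: 'X^d + \poly_(i < d) P`_i.
  apply/polyP => i; rewrite !coefD coefZ !coefXn coef_poly.
  have [->|nid1] := eqVneq i d.+1.
    by rewrite mP1 eqn_leq ltnn /= ltnNge leqnSn mulr0 !addr0.
  have [->|nid] := eqVneq i d; first by rewrite ltnn mulr1 add0r addr0.
  rewrite mulr0 !add0r; case: ltnP => // ledi; rewrite nth_default // szP.
  by rewrite ltn_neqAle eq_sym nid1 ltn_neqAle eq_sym nid.
have cf k : (k < d.+2)%N -> (P \Po ('X - c%:P))`_k = (('X - c%:P) ^+ d.+1)`_k +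
    P`_d * (('X - c%:P) ^+ d)`_k + ((\poly_(i < d) P`_i) \Po ('X - c%:P))`_k.
  move=> _; rewrite {1}PE !comp_polyD comp_polyZ !comp_Xn_poly !coefD coefZ //.
have small k : (d <= k)%N -> ((\poly_(i < d) P`_i) \Po ('X - c%:P))`_k = 0.
  move=> ledk; apply: nth_default; rewrite size_comp_poly2 //.
  exact: leq_trans (size_poly _ _) ledk.
have mexp n : (('X - c%:P) ^+ n)`_n = 1.
  have /monicP := monic_exp n (monicXsubC c).
  by rewrite lead_coefE size_exp_XsubC.
split=> //.
  apply/monicP; rewrite lead_coefE szPc /= cf // small // mexp addr0.
  by rewrite [X in _ * X]nth_default ?size_exp_XsubC // mulr0 addr0.
have cd : c *+ d.+1 = P`_d.
  rewrite /c -mulrnAr -rmorphMn -[_ *+ _]mulr_natl divff ?pnatr_eq0 //.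
  by rewrite rmorph1 mulr1.
by rewrite cf // small // mexp addr0 mulr1 coef_XsubC_exp mulNrn cd addNr.
Qed.

(* [e / j] is the slope of the first edge of the Newton polygon. *)
Lemma newton_slope P d : P \is monic -> size P = d.+2 -> P`_d = 0 ->
    P != 'X^(d.+1) ->
  exists j e (Q : {poly fps C}), [/\ (0 < j)%N, size Q = d.+2, Q \is monic,
    (forall l, (l <= d.+1)%N ->
      fps_expand j P`_l = (fps_z C ^+ e) ^+ (d.+1 - l) * Q`_l) &
    (Q`_d = 0 /\ exists2 l, (l < d)%N & fps_ct Q`_l != 0)].
Proof.
move=> mP szP Pd PnX; pose b (i : 'I_d.+2) := P`_(d.+1 - i).
have mP1 : P`_d.+1 = 1 by have /monicP := mP; rewrite lead_coefE szP.
have [j0 j0P] : exists i : 'I_d.+2, (1 < i)%N && (b i != 0).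
  apply/existsP; rewrite -[X in is_true X]negbK negb_exists.
  apply: contra PnX => /forallP b0; apply/eqP/polyP => i; rewrite coefXn.
  have [->//|nid] := eqVneq i d.+1.
  have [ltid|leid] := ltnP i d.+1; last first.
    by rewrite nth_default // szP ltn_neqAle eq_sym nid.
  have lt2 : (d.+1 - i < d.+2)%N by rewrite ltnS leq_subr.
  have := b0 (Ordinal lt2); rewrite negb_and => /orP[|].
    rewrite -leqNgt [nat_of_ord _]/= => le1; suff -> : i = d by [].
    by move: ltid le1; clear; lia.
  by rewrite negbK /b [nat_of_ord _]/= subKn 1?ltnW // => /eqP.
(* Indices are reversed: [b i] belongs to [X ^ (d.+1 - i)]. The index [0] is the leading term and
   the coefficient at index [1] vanishes, so the minimum is over [i > 1]. *)
pose v (i : 'I_d.+2) : rat := (fps_ord (b i))%:R / i%:R.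
pose nz : pred 'I_d.+2 := fun i => (1 < i)%N && (b i != 0).
have [j /andP[j1 bj] jmin] := @arg_minP _ _ _ j0 nz v j0P.
have j_gt0 : (0 < j)%N by apply: ltn_trans j1.
have slope (i : 'I_d.+2) : (1 < i)%N -> b i != 0 ->
    (fps_ord (b j) * i <= fps_ord (b i) * j)%N.
  move=> i1 bi; have := jmin i; rewrite /nz i1 bi => /(_ isT); rewrite /v.
  rewrite ler_pdivrMr ?ltr0n // mulrAC ler_pdivlMr ?ltr0n ?(ltn_trans _ i1) //.
  by rewrite -!natrM ler_nat.
pose e := fps_ord (b j).
have /choice[u uE] (l : nat) : exists u, (l <= d.+1)%N ->
    fps_expand j P`_l = (fps_z C ^+ e) ^+ (d.+1 - l) * u.
  case: (leqP l d.+1) => [leld|]; last by exists 0.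
  rewrite -exprM.
  have [->|Pl0] := eqVneq P`_l 0; first by exists 0; rewrite rmorph0 mulr0.
  have [->|nld1] := eqVneq l d.+1.
    by exists (fps_expand j P`_d.+1); rewrite subnn muln0 mul1r.
  have [eld|nld] := eqVneq l d; first by rewrite eld Pd eqxx in Pl0.
  have lti : (d.+1 - l < d.+2)%N by rewrite ltnS leq_subr.
  have := slope (Ordinal lti); rewrite /b /= subKn // Pl0 => /(_ _ isT) sl.
  have {}sl : (e * (d.+1 - l) <= fps_ord (P`_l)%R * j)%N.
    by apply: sl; move: leld nld1 nld; clear; lia.
  have [_ Pl_lt] := fps_ordP Pl0.
  eexists => _; apply: fps_dvdzX => k ltk /=.
  case: ifP => // /dvdnP[q kE]; rewrite kE mulnK //; apply: Pl_lt.
  by rewrite -(ltn_pmul2r j_gt0) -kE (leq_trans ltk).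
pose Q := \poly_(l < d.+2) u l.
have QE l : (l <= d.+1)%N -> Q`_l = u l by move=> lel; rewrite coef_poly ltnS lel.
have Qd1 : Q`_d.+1 = 1.
  by have := uE d.+1 (leqnn _); rewrite mP1 rmorph1 subnn mul1r QE.
have szQ : size Q = d.+2.
  apply/eqP; rewrite eqn_leq size_poly /= ltnNge; apply/negP => le.
  by have /eqP := Qd1; rewrite nth_default // eq_sym oner_eq0.
exists j, e, Q; split=> //.
- by apply/monicP; rewrite lead_coefE szQ.
- by move=> l lel; rewrite QE // uE.
split.
  have := uE d (leqnSn d); rewrite Pd rmorph0 QE // => /esym/eqP.
  by rewrite mulf_eq0 -exprM (negPf (fps_zX_neq0 _ _)) => /eqP.
(* At the index that minimises the slope, the division by the power of [z] leaves order zero. *)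
exists (d.+1 - j)%N; first by have := ltn_ord j; move: j1; clear; lia.
have lej : (j <= d.+1)%N by rewrite -ltnS.
rewrite QE ?leq_subr //; have := uE (d.+1 - j)%N (leq_subr _ _).
rewrite -/(b j) subKn // -exprM => /(congr1 (fun a : fps C => a (e * j)%N)).
rewrite fps_coef_zXM leqnn subnn /= dvdn_mull // mulnK // /fps_ct => <-.
by have [] := fps_ordP bj.
Qed.

(** Induction on a bound for the size. Unless the shifted polynomial is a power of [X], rescaling
    along the Newton polygon gives a reduction with two distinct roots, and Hensel's lemma splits
    off a factor of smaller degree. The ramification indices multiply. *)
Theorem puiseux_root P : P \is monic -> (1 < size P)%N ->
  exists2 m, (0 < m)%N & exists r, root (map_poly (fps_expand m) P) r.
Proof.
move: {2}(size P) (leqnn (size P)) => s; elim: s P => [|s IHs] P.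
  by rewrite leqn0 => /eqP ->.
move=> les mP; case szP: (size P) => [|[|d]] // _.
have [c [mPc szPc Pcd]] := tschirnhaus mP szP.
set Pc := P \Po _ in mPc szPc Pcd.
suff [m m0 [r r0]] : exists2 m, (0 < m)%N &
    exists r, root (map_poly (fps_expand m) Pc) r.
  exists m => //; exists (r - fps_expand m c); move: r0; rewrite /root.
  by rewrite /Pc map_comp_poly horner_comp rmorphB /= map_polyX map_polyC !hornerE.
have [->|PcnX] := eqVneq Pc 'X^(d.+1).
  by exists 1%N => //; exists 0; rewrite map_polyXn /root hornerXn expr0n.
have [j [e [Q [j0 szQ mQ PQ [Qd [l ltl Ql]]]]]] := newton_slope mPc szPc Pcd PcnX.
pose q := map_poly (@fps_ct C) Q.
have szq : size q = d.+2.
  by rewrite size_map_poly_id0 // (monicP mQ) rmorph1 oner_neq0.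
have mq : q \is monic by apply: monic_map.
have [r rq] : exists r, root q r by apply: closed_rootP; rewrite szq.
have [k [B] ] := multiplicity_XsubC q r; rewrite monic_neq0 //= => nBr qE.
have k0 : (0 < k)%N.
  by rewrite lt0n; apply: contraNneq nBr => k0; rewrite qE k0 mulr1 in rq.
have mA := monic_exp k (monicXsubC r).
have mB : B \is monic by rewrite qE monicMr in mq.
have szqE : (size B + k)%N = d.+2.
  by rewrite -szq qE size_Mmonic ?monic_neq0 // size_exp_XsubC addnS.
(* If [r] were the only root, [q] would be [(X - r) ^ d.+1]; the missing term of degree [d] forces
   [r = 0], against the non-zero coefficient of degree [l < d]. *)
have ltk : (k.+1 < d.+2)%N.
  rewrite -szqE -[k.+1]add1n ltn_add2r ltnNge; apply/negP => sB1.
  have B1 : B = 1.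
    rewrite (size1_polyC sB1); have /monicP := mB.
    by rewrite {1}(size1_polyC sB1) lead_coefC => ->.
  have kd : k = d.+1 by move: szqE; rewrite B1 size_poly1 => -[].
  have: q`_d = 0 by rewrite coef_map Qd; apply: fps_coef0.
  rewrite qE B1 mul1r kd coef_XsubC_exp => /eqP; rewrite mulrn_eq0 /= oppr_eq0.
  move=> /eqP r0; case/negP: Ql; rewrite -coef_map -/q qE B1 mul1r kd r0 subr0.
  by rewrite coefXn eqn_leq [(d < l)%N]ltnNge (ltnW ltl) andbF.
have co : coprimep (('X - r%:P) ^+ k) B.
  by rewrite coprimep_expl // coprimep_sym coprimep_XsubC.
have := hensel mQ mA mB co; rewrite mulrC => /(_ qE) [A' [B' [mA' szA' _ QAB]]].
rewrite size_exp_XsubC in szA'.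
have [|||m m0 [x xr]] := IHs A' => //.
- by rewrite szA' -ltnS; apply: leq_trans les; rewrite szP.
- by rewrite szA' ltnS.
exists (j * m)%N; first by rewrite muln_gt0 j0.
exists (fps_expand m (fps_z C ^+ e) * x).
have -> : map_poly (fps_expand (j * m)) Pc =
    map_poly (fps_expand m) (map_poly (fps_expand j) Pc).
  by apply/polyP => i; rewrite !coef_map /= fps_expand_comp.
rewrite /root (@horner_scaled _ _ (map_poly (fps_expand m) Q) _ _ d.+1).
- rewrite mulf_eq0; apply/orP; right; move: xr; rewrite /root QAB rmorphM /=.
  by rewrite hornerM => /eqP ->; rewrite mul0r.
- by rewrite (leq_trans (size_poly _ _)) // (leq_trans (size_poly _ _)) // szPc.
- by rewrite (leq_trans (size_poly _ _)) // szQ.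
by move=> i lei; rewrite !coef_map /= PQ // rmorphM rmorphXn.
Qed.

(** Hensel's lemma isolates the factor with reduction [X ^ k]; the constant term of any root of it
    is nilpotent, hence zero. *)
Lemma puiseux_root_ct0 P : P \is monic -> (1 < size P)%N -> fps_ct P`_0 = 0 ->
  exists2 m, (0 < m)%N &
    exists2 r, root (map_poly (fps_expand m) P) r & fps_ct r = 0.
Proof.
move=> mP szP P00; pose q := map_poly (@fps_ct C) P.
have mq : q \is monic by apply: monic_map.
have rq : root q 0 by rewrite /root horner_coef0 coef_map /= P00.
have [k [B] ] := multiplicity_XsubC q 0; rewrite monic_neq0 //= => nBr qE.
have k0 : (0 < k)%N.
  by rewrite lt0n; apply: contraNneq nBr => k0; rewrite qE k0 mulr1 in rq.
have mA := monic_exp k (monicXsubC (0 : C)).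
have mB : B \is monic by rewrite qE monicMr in mq.
have co : coprimep (('X - 0%:P) ^+ k) B.
  by rewrite coprimep_expl // coprimep_sym coprimep_XsubC.
have := hensel mP mA mB co; rewrite mulrC => /(_ qE) [A' [B' [mA' szA' ctA' PAB]]].
have [|m m0 [x xr]] := puiseux_root mA'; first by rewrite szA' size_exp_XsubC.
exists m => //; exists x.
  by move: xr; rewrite /root PAB rmorphM hornerM => /eqP ->; rewrite mul0r.
move: xr => /eqP/(congr1 (@fps_ct C)); rewrite -horner_map -map_poly_comp.
rewrite (eq_map_poly (g := @fps_ct C)) => [|a]; last exact: fps_ct_expand.
rewrite ctA' subr0 hornerXn rmorph0 => /eqP.
by rewrite expf_eq0 k0 => /eqP.
Qed.

End Puiseux.

(** * Laurent series *)

Lemma rmorphism_of (R S : nzRingType) (f : R -> S) :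
  zmod_morphism f -> monoid_morphism f ->
  exists g : {rmorphism R -> S}, g =1 f.
Proof.
move=> fB fM.
pose fz := GRing.isZmodMorphism.Build R S f fB.
pose fm := GRing.isMonoidMorphism.Build R S f fM.
pose g : {rmorphism R -> S} := HB.pack f fz fm.
by exists g.
Qed.

Notation "a %:F" := (@FracField.tofrac _ a).

Lemma fracP (R : idomainType) (x : {fraction R}) :
  exists a b : R, b != 0 /\ x = a%:F / b%:F.
Proof.
set n := \n_(repr x); set d := \d_(repr x).
have d0 : d != 0 := denom_ratioP _.
exists n, d; split=> //.
suff <- : x * d%:F = n%:F by rewrite mulfK ?tofrac_eq0.
rewrite -[x in LHS]reprK; unlock FracField.tofrac.
rewrite -[LHS]FracField.pi_mul; apply/eqmodP.
rewrite /= FracField.equivfE /FracField.mulf !numden_Ratio ?oner_neq0 ?mulr1 //.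
by rewrite mulrC.
Qed.

Lemma frac_extend (R : idomainType) (K : fieldType) (f : {rmorphism R -> K}) :
  (forall a, f a = 0 -> a = 0) ->
  exists g : {rmorphism {fraction R} -> K}, forall a, g a%:F = f a.
Proof.
move=> f0; have fn0 a : a != 0 -> f a != 0 by apply: contra_neq => /f0.
have /choice[n /choice[d ndP]] := @fracP R.
pose g x := f (n x) / f (d x).
have gE x a b : b != 0 -> x = a%:F / b%:F -> g x = f a / f b.
  move=> b0 xab; have [d0 xnd] := ndP x.
  apply/eqP; rewrite /g eqr_div ?fn0 // -!rmorphM; apply/eqP; congr (f _).
  apply/eqP; rewrite -tofrac_eq !tofracM -eqr_div ?tofrac_eq0 //.
  by rewrite -xab -xnd.
have gB : zmod_morphism g.
  move=> x y; have [dx xE] := ndP x; have [dy yE] := ndP y.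
  rewrite (gE (x - y) (n x * d y - n y * d x) (d x * d y)) ?mulf_neq0 //.
    by rewrite /g rmorphB !rmorphM -[in RHS]mulNr addf_div ?fn0 // mulNr.
  rewrite [in LHS]xE [in LHS]yE -mulNr addf_div ?tofrac_eq0 // tofracB !tofracM.
  by rewrite mulNr.
have gM : monoid_morphism g.
  split; first by rewrite (gE 1 1 1) ?oner_neq0 ?rmorph1 ?divr1 // divr1.
  move=> x y; have [dx xE] := ndP x; have [dy yE] := ndP y.
  rewrite (gE (x * y) (n x * n y) (d x * d y)) ?mulf_neq0 //.
    by rewrite /g !rmorphM mulf_div.
  by rewrite [in LHS]xE [in LHS]yE mulf_div !tofracM.
have [h hE] := rmorphism_of gB gM; exists h => a; rewrite hE (gE _ a 1) ?oner_neq0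
  ?tofrac1 ?rmorph1 ?divr1 ?oner_neq0 //.
Qed.

Lemma leq_size_map_poly (R S : nzRingType) (f : R -> S) (p : {poly R}) :
  (size (map_poly f p) <= size p)%N.
Proof. by rewrite /map_poly size_poly. Qed.

Section Laurent.
Variable C : numClosedFieldType.
Local Notation L := (laurent C).
Local Notation z := (fps_z C).

Lemma laurent_factor (x : L) : x != 0 ->
  exists2 u, fps_ct u != 0 & x = z%:F ^ (laurent_ord x) * u%:F.
Proof.
move=> x0; have [a [b [b0 xab]]] := fracP x.
have a0 : a != 0 by apply: contraNneq x0 => a0; rewrite xab a0 tofrac0 mul0r.
rewrite xab laurent_ord_frac //.
have [u u0 aE] := fps_factor a0; have [w w0 bE] := fps_factor b0.
have wU := fps_unit_ct w0.
have z0 : z%:F != 0 by rewrite tofrac_eq0 -[z]expr1 fps_zX_neq0.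
exists (u / w); first by rewrite rmorphM rmorphV ?mulf_neq0 // invr_eq0.
have wF : w%:F != 0 by rewrite tofrac_eq0; apply: contraNneq w0 => ->; apply/eqP.
rewrite expfzDr // -exprnP -invr_expz -exprnP.
rewrite {1}aE {1}bE !tofracM !tofracXn invfM.
have -> : (w^-1)%:F = (w%:F)^-1.
  by apply: (mulIf wF); rewrite mulVf // -tofracM mulVr // tofrac1.
by rewrite mulrACA [X in _ * X]mulrC -!mulrA.
Qed.

Lemma laurent_integral_or_pole (x : L) :
  (exists a, x = a%:F) \/ (exists2 y, fps_ct y = 0 & x * y%:F = 1).
Proof.
have [->|x0] := eqVneq x 0; first by left; exists 0; rewrite tofrac0.
have z0 : z%:F != 0 by rewrite tofrac_eq0 -[z]expr1 fps_zX_neq0.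
have [u u0 ->] := laurent_factor x0; case: (laurent_ord x) => k.
  by left; exists (z ^+ k * u); rewrite tofracM tofracXn.
right; exists (z ^+ k.+1 * u^-1).
  by rewrite exprS -mulrA rmorphM; apply: mul0r.
rewrite NegzE -invr_expz -exprnP !tofracM !tofracXn mulrACA mulVf ?expf_neq0 //.
by rewrite mul1r -tofracM divrr ?fps_unit_ct // tofrac1.
Qed.

Lemma fps_integrally_closed (P : {poly fps C}) (x : L) :
  P \is monic -> root (map_poly (@FracField.tofrac (fps C)) P) x ->
  exists a, x = a%:F.
Proof.
move=> mP /eqP Px; have [//|[y y0 xy]] := laurent_integral_or_pole x.
have sP : (0 < size P)%N by rewrite size_poly_gt0 monic_neq0.
pose n := (size P).-1; have szP : size P = n.+1 by rewrite prednK.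
(* The monic equation is multiplied by [y ^ n], where [y = 1 / x] has zero constant term; modulo [z]
   only the leading coefficient [1] survives. *)
have : \sum_(l < n.+1) P`_l * y ^+ (n - l) = 0.
  apply/eqP; rewrite -tofrac_eq0 rmorph_sum; apply/eqP.
  transitivity (y%:F ^+ n * (map_poly (@FracField.tofrac (fps C)) P).[x]).
    rewrite (@horner_coef_wide _ n.+1) ?(leq_trans (size_poly _ _)) ?szP //.
    rewrite mulr_sumr; apply: eq_bigr => l _; rewrite coef_map rmorphM rmorphXn /=.
    have lel : (l <= n)%N by rewrite -ltnS.
    have -> : y%:F ^+ n = y%:F ^+ (n - l) * y%:F ^+ l by rewrite -exprD subnK.
    rewrite mulrCA -mulrA [_ ^+ l * _]mulrC -exprMn xy expr1n mulr1.
    by [].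
  by rewrite Px mulr0.
have yk k : (0 < k)%N -> fps_ct (y ^+ k) = 0.
  case: k => // k _; rewrite exprS rmorphM -[RHS](mul0r (fps_ct (y ^+ k))).
  by congr (_ * _).
have -> : \sum_(l < n.+1) P`_l * y ^+ (n - l) =
    \sum_(l < n) P`_l * y ^+ (n - l) + 1.
  have Pn : P`_n = 1 by have /monicP := mP; rewrite lead_coefE.
  by rewrite big_ord_recr /= subnn mulr1 Pn.
move=> /(congr1 (@fps_ct C)); rewrite rmorphD rmorph_sum big1 => [|l _]; last first.
  by rewrite rmorphM [X in _ * X]yk ?mulr0 // subn_gt0 ltn_ord.
by rewrite add0r rmorph1 rmorph0 => /eqP; rewrite oner_eq0.
Qed.

(** The extension of a ramification to Laurent series is specified by its values on power series,
    which determine it ([expanding_unique]). *)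
Definition expanding m (E : {rmorphism L -> L}) :=
  forall a, E a%:F = (fps_expand m a)%:F.

Lemma expanding_exists m : (0 < m)%N -> exists E, expanding m E.
Proof.
move=> m0; apply: (@frac_extend _ _ (@FracField.tofrac (fps C) \o fps_expand m)).
move=> a /= /eqP; rewrite tofrac_eq0 => /eqP a0.
by apply: (fps_expand_inj m0); rewrite a0 rmorph0.
Qed.

Lemma expanding_const m (E : {rmorphism L -> L}) x : (0 < m)%N -> expanding m E ->
  E (laurent_const x) = laurent_const x.
Proof. by move=> m0 EE; rewrite /laurent_const /= EE fps_expand_const. Qed.

Lemma common_denominator (P : {poly L}) :
  exists2 D : fps C, D != 0 & forall i, exists q, P`_i * D%:F = q%:F.
Proof.
have /choice[n /choice[d ndP]] := @fracP (fps C).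
exists (\prod_(i < size P) d P`_i).
  by apply/prodf_neq0 => i _; have [] := ndP P`_i.
move=> i; have [lti|lei] := ltnP i (size P); last first.
  by exists 0; rewrite nth_default // mul0r tofrac0.
exists (n P`_i * \prod_(j < size P | j != Ordinal lti) d P`_j).
rewrite (bigD1 (Ordinal lti)) //= !tofracM mulrA; congr (_ * _).
have [d0 {1}->] := ndP P`_i; by rewrite mulfVK // tofrac_eq0.
Qed.

Lemma laurent_root_monic (P : {poly L}) : P \is monic -> (1 < size P)%N ->
  exists2 m, (0 < m)%N & forall E, expanding m E ->
    exists r, root (map_poly E P) r.
Proof.
move=> mP szP1.
have [D D0 /choice[q qE]] := common_denominator P.
case szP: (size P) szP1 => [|[|n]] // _.
have Pn : P`_n.+1 = 1 by have /monicP := mP; rewrite lead_coefE szP.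
(* This is [D ^ n.+1 * P(X / D)]: monic over the power series, with roots [D] times those of [P]. *)
pose Q := 'X^(n.+1) + \poly_(l < n.+1) (q l * D ^+ (n - l)).
have Qn : Q`_n.+1 = 1.
  by rewrite coefD coefXn eqxx coef_poly ltnn addr0.
have Ql l : (l <= n)%N -> Q`_l = q l * D ^+ (n - l).
  move=> lel; rewrite coefD coefXn coef_poly ltnS lel.
  by rewrite eqn_leq [(n < l)%N]ltnNge lel andbF add0r.
have szQ : size Q = n.+2.
  rewrite size_polyDl size_polyXn //.
  by rewrite ltnS size_poly.
have mQ : Q \is monic by rewrite monicE lead_coefE szQ Qn.
have [|m m0 [s sQ]] := puiseux_root mQ; first by rewrite szQ.
exists m => // E EE; pose w := (fps_expand m D)%:F.
have w0 : w != 0.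
  rewrite tofrac_eq0; apply: contra_neq D0 => D0.
  by apply: (fps_expand_inj m0); rewrite D0 rmorph0.
pose Q' := map_poly (@FracField.tofrac (fps C)) (map_poly (fps_expand m) Q).
have Q'0 : Q'.[s%:F] = 0 by rewrite /Q' horner_map (eqP sQ) rmorph0.
have key : Q'.[w * (s%:F / w)] = w ^+ n.+1 * (map_poly E P).[s%:F / w].
  apply: horner_scaled.
  - by rewrite (leq_trans (leq_size_map_poly _ _)) // (leq_trans (leq_size_map_poly _
    _)) // szQ.
  - by rewrite (leq_trans (leq_size_map_poly _ _)) // szP.
  move=> l; rewrite leq_eqVlt => /orP[/eqP->|].
    by rewrite subnn mul1r !coef_map /= Pn Qn !rmorph1.
  rewrite ltnS => lel; rewrite !coef_map /= Ql // rmorphM rmorphXn tofracM tofracXn.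
  by rewrite -EE -qE rmorphM EE -/w -mulrA -exprS -subSn // [RHS]mulrC.
exists (s%:F / w); apply/eqP; move/eqP: key.
rewrite mulrC divfK // Q'0 eq_sym mulf_eq0 expf_eq0 /= (negPf w0) => /eqP.
exact.
Qed.

Lemma laurent_root (P : {poly L}) : (1 < size P)%N ->
  exists2 m, (0 < m)%N & forall E, expanding m E ->
    exists r, root (map_poly E P) r.
Proof.
move=> szP; have P0 : P != 0 by rewrite -size_poly_gt0 ltnW.
have l0 : (lead_coef P)^-1 != 0 by rewrite invr_eq0 lead_coef_eq0.
have mP : (lead_coef P)^-1 *: P \is monic.
  by rewrite monicE lead_coefZ mulVf // lead_coef_eq0.
have [|m m0 rootP] := laurent_root_monic mP; first by rewrite size_scale.
exists m; first exact: m0.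
move=> E EE; have [r rP] := rootP E EE.
exists r.
move: rP; rewrite map_polyZ.
rewrite /root hornerZ mulf_eq0.
rewrite fmorph_eq0.
by rewrite (negPf l0).
Qed.

End Laurent.

(** * Isomorphisms between subfields of C and of C((z)) *)

Lemma subf_div (K : fieldType) (a b c d : K) : b != 0 -> d != 0 ->
  a / b - c / d = (a * d - c * b) / (b * d).
Proof. by move=> b0 d0; rewrite -mulNr addf_div // mulNr. Qed.

Lemma divf_div (K : fieldType) (a b c d : K) :
  (a / b) / (c / d) = (a * d) / (b * c).
Proof. by rewrite invf_div mulf_div. Qed.

Definition compatible (R : nzRingType) (A B : fieldType) (f : R -> A) (g : R -> B) :=
  forall r, f r = 0 <-> g r = 0.

Section CommonFractionField.
Variables (R : comNzRingType) (A B : fieldType).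
Variables (f : {rmorphism R -> A}) (g : {rmorphism R -> B}).

(** The graph of the isomorphism between the fraction fields of the two images. A single abstract
    field then carries both embeddings as projections. *)
Definition common_frac (fg : compatible f g) : {pred A * B} :=
  [pred x | `[< exists a b, f b != 0 /\ x = (f a / f b, g a / g b) >] ].

Hypothesis fg : compatible f g.

Lemma compatible_neq0 r : f r != 0 -> g r != 0.
Proof. by apply: contra_neq => /fg. Qed.

Lemma common_fracP x : reflect
  (exists a b, f b != 0 /\ x = (f a / f b, g a / g b)) (x \in common_frac fg).
Proof. exact: asboolP. Qed.

Lemma pairV (x : A) (y : B) : x != 0 -> y != 0 -> (x, y)^-1 = (x^-1, y^-1).
Proof. by move=> x0 y0; apply: mulr1_eq; congr (_, _); rewrite divff. Qed.

Lemma common_frac_divring_closed : divring_closed (common_frac fg).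
Proof.
split.
- by apply/common_fracP; exists 1, 1; rewrite !rmorph1 oner_neq0 !divr1.
- move=> _ _ /common_fracP[a [b [b0 ->]]] /common_fracP[c [d [d0 ->]]].
  apply/common_fracP; exists (a * d - c * b), (b * d).
  rewrite !rmorphM mulf_neq0 //; split=> //; rewrite !rmorphB !rmorphM.
  by rewrite -!subf_div ?compatible_neq0.
move=> x _ /common_fracP[a [b [b0 ->]]] /common_fracP[c [d [d0 ->]]].
apply/common_fracP.
(* Inversion in [A * B] is componentwise when both components are non-zero; compatibility excludes
   that exactly one vanishes. *)
have [c0|c0] := eqVneq (f c) 0.
  exists 0, 1; rewrite !rmorph1 !rmorph0 oner_neq0 !mul0r; split=> //.
  have -> : g c = 0 by apply/fg.
  by rewrite c0 !mul0r -[(0, 0)]/(0 : A * B) invr0 mulr0.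
have gc0 := compatible_neq0 c0; have gd0 := compatible_neq0 d0.
exists (a * d), (b * c); rewrite !rmorphM mulf_neq0 //; split=> //.
rewrite pairV ?mulf_neq0 ?invr_eq0 //.
by congr (_, _); apply: divf_div.
Qed.

HB.instance Definition _ := GRing.isDivringClosed.Build (A * B)%type
  (common_frac fg) common_frac_divring_closed.

Record common_field :=
  CommonField { common_val : A * B; _ : common_val \in common_frac fg }.

HB.instance Definition _ := [isSub for common_val].
HB.instance Definition _ := [Choice of common_field by <:].
HB.instance Definition _ := [SubChoice_isSubComUnitRing of common_field by <:].

Lemma common_field_axiom : GRing.field_axiom common_field.
Proof.
move=> x x0; have /common_fracP[a [b [b0 xE]]] := valP x.
have a0 : f a != 0.
  apply: contra_neq x0 => a0; apply: val_inj; rewrite xE a0.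
  by have -> : g a = 0 by [apply/fg]; rewrite !mul0r rmorph0.
have ga0 := compatible_neq0 a0; have gb0 := compatible_neq0 b0.
have vP : (f b / f a, g b / g a) \in common_frac fg.
  by apply/common_fracP; exists b, a.
apply/unitrPr; exists (CommonField vP); apply: val_inj.
rewrite rmorphM rmorph1 /= xE; congr (_, _).
  by rewrite /= mulf_div [f b * _]mulrC divff ?mulf_neq0.
by rewrite /= mulf_div [g b * _]mulrC divff ?mulf_neq0.
Qed.

HB.instance Definition _ :=
  GRing.ComUnitRing_isField.Build common_field common_field_axiom.

Lemma common_fraction_field : exists (K : fieldType) (j : {rmorphism R -> K})
    (i : {rmorphism K -> A}) (t : {rmorphism K -> B}),
  [/\ forall r, i (j r) = f r, forall r, t (j r) = g r &
      forall k, exists a b, k = j a / j b].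
Proof.
have jP r : (f r, g r) \in common_frac fg.
  by apply/common_fracP; exists r, 1; rewrite !rmorph1 oner_neq0 !divr1.
pose j r : common_field := CommonField (jP r).
have jB : zmod_morphism j.
  by move=> x y; apply: val_inj; rewrite rmorphB /= !rmorphB.
have jM : monoid_morphism j.
  split=> [|x y]; apply: val_inj; first by rewrite rmorph1 /= !rmorph1.
  by rewrite rmorphM /= !rmorphM.
have [h hE] := rmorphism_of jB jM.
exists common_field, h, (fst \o \val), (snd \o \val).
split=> [r|r|k]; rewrite ?hE //=.
have /common_fracP[a [b [b0 kE]]] := valP k.
exists a, b; rewrite !hE.
have jb0 : j b != 0.
  by apply: contra_neq b0 => /(congr1 (fst \o common_val)) /= ->.
apply: (mulIf jb0); rewrite divfK //; apply: val_inj; rewrite rmorphM /= kE.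
by congr (_, _); rewrite /= divfK ?compatible_neq0.
Qed.

End CommonFractionField.

Definition enumerable (T : Type) := exists e : nat -> T, forall x, exists n, e n = x.

Lemma enumerable_surj (S T : Type) (f : S -> T) :
  (forall y, exists x, f x = y) -> enumerable S -> enumerable T.
Proof.
move=> fsurj [e eP]; exists (f \o e) => y.
by have [x <-] := fsurj y; have [n <-] := eP x; exists n.
Qed.

Lemma enumerable_countType (T : countType) (x0 : T) : enumerable T.
Proof.
exists (fun n => odflt x0 (unpickle n)) => x; exists (pickle x).
by rewrite pickleK.
Qed.

Lemma enumerable_pair (S T : Type) :
  enumerable S -> enumerable T -> enumerable (S * T).
Proof.
move=> [e eP] [f fP].
apply: (@enumerable_surj (nat * nat)%type _ (fun n => (e n.1, f n.2))).
  by move=> [x y]; have [n <-] := eP x; have [m <-] := fP y; exists (n, m).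
exact: (@enumerable_countType _ (0%N, 0%N)).
Qed.

Lemma enumerable_seq (T : Type) : enumerable T -> enumerable (seq T).
Proof.
move=> [e eP]; apply: (@enumerable_surj (seq nat) _ (map e)).
  elim=> [|x s [ns <-]]; first by exists [::].
  by have [n <-] := eP x; exists (n :: ns).
exact: (@enumerable_countType _ [::]).
Qed.

Lemma enumerable_poly (R : nzRingType) : enumerable R -> enumerable {poly R}.
Proof.
move=> eR; apply: (enumerable_surj (f := @Poly R)) (enumerable_seq eR).
by move=> p; exists p; rewrite polyseqK.
Qed.

Lemma enumerable_mpoly n (R : nzRingType) : enumerable R -> enumerable {mpoly R[n]}.
Proof.
move=> eR; have eM : enumerable 'X_{1..n} := @enumerable_countType _ 0%MM.
apply: (enumerable_surj (f := fun s : seq (R * 'X_{1..n}) =>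
  \sum_(x <- s) x.1 *: 'X_[x.2])) (enumerable_seq (enumerable_pair eR eM)).
move=> p; exists [seq (p@_m, m) | m <- msupp p].
by rewrite big_map /= -mpolyE.
Qed.

(** No countable union of finite sets covers [T]. The sets to avoid are finite sets of roots, one
    for each of countably many polynomials. *)
Definition uncountable (T : eqType) :=
  forall e : nat -> seq T, exists c, forall n, c \notin e n.

Lemma roots_in_seq (K L : idomainType) (f : {rmorphism K -> L}) (P : {poly L}) :
  injective f -> P != 0 -> exists s : seq K, forall c, root P (f c) -> c \in s.
Proof.
move=> f_inj; move: {2}(size P) (leqnn (size P)) => n.
elim: n P => [|n IHn] P; first by rewrite size_poly_leq0 => ->.
move=> szP P0; case: (pselect (exists c, root P (f c))) => [[c Pc]|noroot].
  have /factor_theorem[Q QE] := Pc.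
  have Q0 : Q != 0 by apply: contraNneq P0 => Q0; rewrite QE Q0 mul0r.
  have [|s sP] := IHn Q _ Q0.
    by rewrite QE size_Mmonic ?monicXsubC // size_XsubC addn2 in szP.
  exists (c :: s) => d; rewrite QE rootM root_XsubC inE => /orP[/sP->|].
    by rewrite orbT.
  by rewrite (inj_eq f_inj) => ->.
by exists [::] => c Pc; case: noroot; exists c.
Qed.

(** The last clause is irreducibility in the form used later: by Bezout, a polynomial not divisible
    by [M] vanishes at no root of [M], whatever field contains that root. *)
Lemma minimal_polynomial (K L : fieldType) (i : {rmorphism K -> L}) (t : L) P :
  P != 0 -> root (map_poly i P) t ->
  exists M : {poly K}, [/\ M \is monic, (1 < size M)%N,
    forall p, root (map_poly i p) t <-> M %| p &
    forall p, ~~ (M %| p) -> coprimep M p].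
Proof.
move=> P0 Pt; pose ann n := exists M : {poly K},
  [/\ M != 0, size M = n & root (map_poly i M) t].
have ex_ann : exists n, `[< ann n >] by exists (size P); apply/asboolP; exists P.
case: (ex_minnP ex_ann) => n /asboolP[M [M0 szM Mt]] nmin.
have small p : root (map_poly i p) t -> (size p < size M)%N -> p = 0.
  move=> pt; rewrite ltnNge; apply: contraNeq => p0; rewrite szM; apply: nmin.
  by apply/asboolP; exists p.
have l0 : (lead_coef M)^-1 != 0 by rewrite invr_eq0 lead_coef_eq0.
have dvdM p : root (map_poly i p) t <-> M %| p.
  split=> [pt|/dvdpP[q ->]]; last first.
    by move: Mt; rewrite !rootE rmorphM hornerM => /eqP ->; rewrite mulr0.
  apply/modp_eq0P; apply: small; last by rewrite ltn_modp.
  move: pt; rewrite {1}(divp_eq p M) rmorphD rmorphM !rootE hornerD hornerM.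
  by move: Mt; rewrite rootE => /eqP ->; rewrite mulr0 add0r.
exists ((lead_coef M)^-1 *: M); split.
- by rewrite monicE lead_coefZ mulVf // lead_coef_eq0.
- rewrite size_scale // ltnNge; apply/negP => szM1.
  move: Mt M0; rewrite (size1_polyC szM1) map_polyC rootC fmorph_eq0 => /eqP ->.
  by rewrite eqxx.
- by move=> p; rewrite dvdpZl.
move=> p; rewrite dvdpZl // => nMp; rewrite coprimepZl //.
rewrite coprimep_def eqn_leq lt0n size_poly_eq0 gcdp_eq0 (negPf M0) /= andbT.
have /dvdpP[q ME] := dvdp_gcdl M p.
have : root (map_poly i M) t by [].
rewrite {1}ME rmorphM rootM => /orP[/dvdM qt|dt].
  have q0 : q != 0 by apply: contraNneq M0 => q0; rewrite ME q0 mul0r.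
  have d0 : gcdp M p != 0 by rewrite gcdp_eq0 (negPf M0).
  have := dvdp_leq q0 qt; rewrite {1}ME size_mul // -subn1 leq_subLR addnC.
  by rewrite leq_add2r.
case/negP: nMp; have /dvdM Md := dt.
exact: dvdp_trans Md (dvdp_gcdr _ _).
Qed.

Section Places.
Variables (C : numClosedFieldType) (F : fieldType) (io : {rmorphism F -> C}).
Local Notation L := (laurent C).

(* An isomorphism over F between a countable subfield of C and a subfield of
   C((z)); pl_field abstracts both. *)
Record place := Place {
  pl_field :> fieldType;
  pl_base : {rmorphism F -> pl_field};
  pl_in : {rmorphism pl_field -> C};
  pl_out : {rmorphism pl_field -> L};
  pl_in_base : forall x, pl_in (pl_base x) = io x;
  pl_out_base : forall x, pl_out (pl_base x) = laurent_const (io x);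
  pl_enum : enumerable pl_field
}.

(** The embeddings into [C] agree; those into [C((z))] agree only after the ramification that
    adjoining a root may demand. *)
Definition place_extends m (P Q : place) :=
  exists j : {rmorphism P -> Q}, (forall x, pl_in Q (j x) = pl_in P x) /\
    forall E, expanding m E -> forall x, pl_out Q (j x) = E (pl_out P x).

Lemma expanding_unique m (E E' : {rmorphism L -> L}) :
  expanding m E -> expanding m E' -> E =1 E'.
Proof.
move=> EE EE' x; have [a [b [_ ->]]] := fracP x.
by rewrite !fmorph_div EE EE' EE EE'.
Qed.

Lemma place_extends_trans m k P Q T : (0 < m)%N -> (0 < k)%N ->
  place_extends m P Q -> place_extends k Q T -> place_extends (m * k) P T.
Proof.
move=> m0 k0 [j [jin jout]] [l [lin lout]].
exists (l \o j); split=> [x|E EE x] /=; first by rewrite lin jin.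
have [Em EmE] := expanding_exists C m0; have [Ek EkE] := expanding_exists C k0.
rewrite (lout _ EkE) (jout _ EmE).
have EEmk : expanding (m * k) (Ek \o Em).
  by move=> a; rewrite /= EmE EkE fps_expand_comp.
by rewrite (expanding_unique EE EEmk).
Qed.

(** Evaluation at [t] and evaluation at [s] have the same kernel in the polynomials over [P]; their
    common fraction field is the new place. *)
Lemma place_adjoin_at (P : place) m E (t : C) (s : L) :
    (0 < m)%N -> expanding m E ->
    (forall p : {poly P}, root (map_poly (pl_in P) p) t <->
      root (map_poly (E \o pl_out P) p) s) ->
  exists2 Q, place_extends m P Q & exists2 u : Q, pl_in Q u = t & pl_out Q u = s.
Proof.
move=> m0 EE ts.
pose f : {rmorphism {poly P} -> C} := horner_eval t \o map_poly (pl_in P).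
pose g : {rmorphism {poly P} -> L} := horner_eval s \o map_poly (E \o pl_out P).
have fg : compatible f g.
  move=> p; have := ts p; rewrite !rootE => ptE.
  by split=> /eqP /ptE /eqP.
have [K [j [i [o [ij oj jfrac]]]]] := common_fraction_field fg.
have fC x : f x%:P = pl_in P x by rewrite /f /= /horner_eval map_polyC hornerC.
have gC x : g x%:P = E (pl_out P x).
  by rewrite /g /= /horner_eval map_polyC hornerC.
pose base : {rmorphism F -> K} := j \o (polyC \o pl_base P).
have in_base x : i (base x) = io x by rewrite /base /= ij fC pl_in_base.
have out_base x : o (base x) = laurent_const (io x).
  by rewrite /base /= oj gC pl_out_base (expanding_const _ m0 EE).
have enumK : enumerable K.
  have eP := enumerable_poly (pl_enum P).
  apply: (enumerable_surj (f := fun x => j x.1 / j x.2)) (enumerable_pair eP eP).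
  by move=> k; have [a [b ->]] := jfrac k; exists (a, b).
exists (Place in_base out_base enumK).
  exists (j \o polyC); split=> [x|E' EE' x] /=; first by rewrite ij fC.
  by rewrite oj gC (expanding_unique EE EE').
exists (j 'X) => /=; first by rewrite ij /f /= /horner_eval map_polyX hornerX.
by rewrite oj /g /= /horner_eval map_polyX hornerX.
Qed.

Lemma place_adjoin_root (P : place) (M : {poly P}) m E (t : C) (s : L) :
    (0 < m)%N -> expanding m E ->
    (forall p, root (map_poly (pl_in P) p) t <-> M %| p) ->
    (forall p, ~~ (M %| p) -> coprimep M p) ->
    root (map_poly (E \o pl_out P) M) s ->
  exists2 Q, place_extends m P Q & exists2 u : Q, pl_in Q u = t & pl_out Q u = s.
Proof.
move=> m0 EE tM coM Ms; apply: place_adjoin_at m0 EE _ => p.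
split=> [/tM/dvdpP[q ->]|ps]; first by rewrite rmorphM rootM Ms orbT.
apply/tM; case: (boolP (M %| p)) => // /coM /Bezout_eq1_coprimepP[[a b] /= ab1].
have := congr1 (fun q => (map_poly (E \o pl_out P) q).[s]) ab1.
rewrite rmorphD !rmorphM rmorph1 hornerD !hornerM hornerC.
rewrite (eqP Ms) (eqP ps) !mulr0 addr0 => /eqP.
by rewrite eq_sym oner_eq0.
Qed.

Hypothesis uncC : uncountable C.

(* A transcendental [t] may be sent to any constant that avoids the countably many
   algebraic relations over the image. *)
Lemma place_adjoin (P : place) (t : C) :
  exists2 m, (0 < m)%N & exists2 Q, place_extends m P Q & exists u : Q, pl_in Q u = t.
Proof.
have [[p [p0 pt]]|transc] :=
    pselect (exists p : {poly P}, p != 0 /\ root (map_poly (pl_in P) p) t).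
  have [M [mM szM tM coM]] := minimal_polynomial p0 pt.
  have [|m m0 rootM] := @laurent_root _ (map_poly (pl_out P) M).
    by rewrite size_map_poly.
  exists m => //; have [E EE] := expanding_exists C m0.
  have [s Ms] := rootM E EE; rewrite -map_poly_comp in Ms.
  have [Q PQ [u ut _]] := place_adjoin_root m0 EE tM coM Ms.
  by exists Q => //; exists u.
have [e eP] := enumerable_poly (pl_enum P).
have [E EE] := expanding_exists C (ltn0Sn 0).
have rootsP n : exists s : seq C, e n != 0 -> forall c,
    root (map_poly (E \o pl_out P) (e n)) (laurent_const c) -> c \in s.
  have [->|en0] := eqVneq (e n) 0; first by exists [::].
  have inj : injective (@laurent_const C) by apply: fmorph_inj.
  have [|s sP] := roots_in_seq (P := map_poly (E \o pl_out P) (e n)) inj.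
    by rewrite map_poly_eq0.
  by exists s.
have /choice[s sP] := rootsP.
have [c cs] := uncC s.
have ts p : root (map_poly (pl_in P) p) t <->
    root (map_poly (E \o pl_out P) p) (laurent_const c).
  have [->|p0] := eqVneq p 0; first by rewrite !rmorph0 !root0.
  split=> [pt|pc]; first by case: transc; exists p.
  have [n en] := eP p; have /negP[] := cs n.
  by apply: sP; rewrite en.
have [Q PQ [u ut _]] := place_adjoin_at (ltn0Sn 0) EE ts.
by exists 1%N => //; exists Q => //; exists u.
Qed.

Lemma place_extends_refl P : place_extends 1 P P.
Proof.
exists idfun; split=> // E EE x /=.
have E1 : expanding 1 (idfun : {rmorphism L -> L}).
  move=> a; congr (FracField.tofrac _); apply: fpsP => n /=.
  by rewrite dvd1n divn1.
by rewrite (expanding_unique EE E1).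
Qed.

Lemma place_adjoin_seq (P : place) (ts : seq C) :
  exists2 m, (0 < m)%N & exists2 Q, place_extends m P Q &
    forall t, t \in ts -> exists u : Q, pl_in Q u = t.
Proof.
elim: ts => [|t ts [m m0 [Q PQ Qts]]].
  by exists 1%N => //; exists P => //; apply: place_extends_refl.
have [k k0 [T QT [u ut]]] := place_adjoin Q t.
exists (m * k)%N; first by rewrite muln_gt0 m0.
exists T; first exact: place_extends_trans PQ QT.
move=> t'; rewrite inE => /orP[/eqP->|/Qts[w <-]]; first by exists u.
by have [j [jin _]] := QT; exists (j w).
Qed.

End Places.

(** * Noether normalization *)

Lemma mmap_rmorph n (R : nzRingType) (S T : comNzRingType) (f : {rmorphism R -> S})
    (h : 'I_n -> S) (g : {rmorphism S -> T}) (p : {mpoly R[n]}) :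
  g (mmap f h p) = mmap (g \o f) (g \o h) p.
Proof.
rewrite /mmap rmorph_sum; apply: eq_bigr => m _.
rewrite rmorphM rmorph_prod; congr (_ * _); apply: eq_bigr => i _.
by rewrite rmorphXn.
Qed.

Lemma eq_mmap n (R S : nzRingType) (f f' : R -> S) (h h' : 'I_n -> S) :
  f =1 f' -> h =1 h' -> mmap f h =1 mmap f' h'.
Proof.
move=> ff' hh' p; apply: eq_bigr => m _; rewrite ff'; congr (_ * _).
by apply: eq_bigr => i _; rewrite hh'.
Qed.

Lemma mmap_XU n (R S : comNzRingType) (f : {rmorphism R -> S}) (h : 'I_n -> S) i :
  mmap f h 'X_i = h i.
Proof. by rewrite mmapX mmap1U. Qed.

Lemma mmap_id n (R : comNzRingType) (p : {mpoly R[n]}) :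
  mmap (@mpolyC n R) (fun i => 'X_i) p = p.
Proof.
rewrite [in RHS](mpolyE p) /mmap; apply: eq_bigr => m _.
by rewrite mmap1_id mul_mpolyC.
Qed.

(** Since [c] may be zero, this passes to products over any commutative ring. *)
Definition has_top (R : nzRingType) d (c : R) (p : {poly R}) :=
  (size p <= d.+1)%N /\ p`_d = c.

Lemma has_topM (R : comNzRingType) d e (b c : R) p q :
  has_top d b p -> has_top e c q -> has_top (d + e) (b * c) (p * q).
Proof.
move=> [szp <-] [szq <-]; split.
  by apply: leq_trans (size_polyMleq _ _) _; move: (size p) (size q) szp szq; lia.
have lt : (d < (d + e).+1)%N by rewrite ltnS leq_addr.
rewrite coefM (bigD1 (Ordinal lt)) //= addKn big1 ?addr0 // => i.
rewrite -val_eqE /= neq_ltn => /orP[lti|lti].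
  rewrite [q`__]nth_default ?mulr0 // (leq_trans szq) //.
  by move: lti; case: i => i /=; lia.
by rewrite nth_default ?mul0r // (leq_trans szp).
Qed.

Lemma has_topX (R : comNzRingType) d (c : R) p k :
  has_top d c p -> has_top (k * d) (c ^+ k) (p ^+ k).
Proof.
move=> pc; elim: k => [|k IHk].
  by split; rewrite ?size_poly1 // mul0n expr0 coef1.
by rewrite !exprS mulSn; apply: has_topM.
Qed.

(** Along a line of direction [la], only the homogeneous part of degree [d] reaches [X ^ d], and it
    is evaluated at the direction. *)
Lemma has_top_linear_subst n (F : nzRingType) (R : comNzRingType)
    (f : {rmorphism F -> R}) (c la : 'I_n -> R) (P : {mpoly F[n]}) d :
  (msize P <= d.+1)%N ->
  has_top d (mmap f la (pihomog mdeg d P))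
    (mmap (@polyC R \o f) (fun i => (c i)%:P + (la i)%:P * 'X) P).
Proof.
set th := fun i => _.
have topm m : has_top (mdeg m) (mmap1 la m) (mmap1 th m).
  rewrite mdegE /mmap1; elim/big_rec3: _ => [|i x a b _ IH].
    by split; rewrite ?size_poly1 // coef1.
  apply: has_topM IH; rewrite -[X in has_top X]muln1; apply: has_topX; split.
    rewrite (leq_trans (size_polyD _ _)) // geq_max (leq_trans (size_polyC_leq1 _)) //.
    rewrite (leq_trans (size_polyMleq _ _)) // size_polyX addn2 /=.
    by rewrite ltnS size_polyC_leq1.
  by rewrite coefD coefC coefCM coefX mulr1 add0r.
move=> szP; split.
  rewrite /mmap (leq_trans (size_sum _ _ _)) //.
  rewrite big_seq; apply/bigmax_leqP_seq => m mP _ //=.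
  rewrite mul_polyC (leq_trans (size_scale_leq _ _)) //.
  have [szm _] := topm m; rewrite (leq_trans szm) //.
  by apply: leq_trans (msize_mdeg_lt mP) szP.
rewrite /mmap coef_sum pihomogE -/(mmap f la _) rmorph_sum /=.
rewrite [RHS]big_mkcond /=; apply: eq_big_seq => m mP.
rewrite coefCM; case: eqP => [<-|/eqP nm].
  by have [_ ->] := topm m; rewrite mmapZ mmapX.
have [szm _] := topm m; rewrite nth_default ?mulr0 // (leq_trans szm) //.
have := leq_trans (msize_mdeg_lt mP) szP.
by rewrite ltnS leq_eqVlt (negPf nm).
Qed.

(** A natural number is asked for because ring morphisms preserve it: it has the same meaning in [F]
    and in [C]. *)
Lemma natural_nonroot (F : fieldType) (q : {poly F}) :
  [pchar F] =i pred0 -> q != 0 -> exists c : nat, ~~ root q c%:R.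
Proof.
move=> /pcharf0P F0 q0; pose rs : seq F := [seq i%:R | i <- iota 0 (size q)].
have [/allP rsq|/allPn[_ /mapP[c _ ->] qc]] := boolP (all (root q) rs); last by exists c.
have : (size rs < size q)%N.
  apply: max_poly_roots => //; first exact/allP.
  rewrite map_inj_uniq ?iota_uniq // => i j ij.
  wlog leij : i j ij / (i <= j)%N.
    by case: (leqP i j) => [le|/ltnW le] H; [apply: H|apply/esym/H].
  have : ((j - i)%:R == 0 :> F) by rewrite natrB // ij subrr.
  by rewrite F0 subn_eq0 => leji; apply/eqP; rewrite eqn_leq leij.
by rewrite size_map size_iota ltnn.
Qed.

Lemma mpoly_nonvanishing n (F : fieldType) (P : {mpoly F[n]}) :
  [pchar F] =i pred0 -> P != 0 -> exists v, P.@[v] != 0.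
Proof.
move=> F0; elim: n P => [|n IHn] P P0.
  exists (fun _ => 0); apply: contraNneq P0 => Pv; apply/eqP/mpolyP => m.
  have m0 : m = 0%MM by apply/mnmP => -[].
  rewrite mcoeff0 m0 -[RHS]Pv.
  have -> : P = (P@_0)%:MP.
    by apply: msize1_polyC; rewrite msizeE; apply/bigmax_leqP_seq => k _ _; rewrite
      mdegE big_ord0.
  by rewrite mevalC mcoeffC eqxx mulr1.
pose th i : {poly {mpoly F[n]}} :=
  if unlift ord0 i is Some j then ('X_j)%:P else 'X.
pose u := mmap (@polyC _ \o @mpolyC n F) th P.
pose back : {rmorphism {mpoly F[n]} -> {mpoly F[n.+1]}} :=
  mmap (@mpolyC n.+1 F) (fun i => 'X_(lift ord0 i)).
have u0 : u != 0.
  apply: contraNneq P0 => u0.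
  pose g : {rmorphism {poly {mpoly F[n]}} -> {mpoly F[n.+1]}} :=
    horner_eval 'X_ord0 \o map_poly back.
  have gu : g u = P.
    rewrite /u mmap_rmorph -[RHS]mmap_id; apply: eq_mmap => [c|i].
      by rewrite /g /= /horner_eval map_polyC hornerC /= mmapC.
    rewrite /g /= /horner_eval /th; case: unliftP => [j ->|->].
      by rewrite map_polyC hornerC /= mmap_XU.
    by rewrite map_polyX hornerX.
  by rewrite -gu u0 rmorph0.
have [v lv] : exists v, (lead_coef u).@[v] != 0 by apply: IHn; rewrite lead_coef_eq0.
pose q := map_poly (meval v) u.
have q0 : q != 0.
  apply: contraNneq lv => q0; rewrite -[(lead_coef u).@[v]]coef_map -/q.
  by rewrite q0 coef0.
have [k qt] := natural_nonroot F0 q0; set t := k%:R in qt.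
exists (fun i => if unlift ord0 i is Some j then v j else t).
suff -> : P.@[fun i => if unlift ord0 i is Some j then v j else t] = q.[t] by [].
pose g : {rmorphism {poly {mpoly F[n]}} -> F} :=
  horner_eval t \o map_poly (meval v).
rewrite -[RHS]/(g u) /u mmap_rmorph; apply: eq_mmap => [c|i].
  by rewrite /g /= /horner_eval map_polyC hornerC /= mevalC.
rewrite /g /= /horner_eval /th; case: unliftP => [j _|_].
  by rewrite map_polyC hornerC /= mevalXU.
by rewrite map_polyX hornerX.
Qed.

Lemma mmap_homog_scale n (R : nzRingType) (S : comNzRingType)
    (f : {rmorphism R -> S}) (h : 'I_n -> S) c d (p : {mpoly R[n]}) :
  p \is d.-homog -> mmap f (fun i => c * h i) p = c ^+ d * mmap f h p.
Proof.
move=> /dhomogP hp; rewrite /mmap mulr_sumr; apply: eq_big_seq => m mp.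
rewrite mulrCA; congr (_ * _); rewrite /mmap1.
under eq_bigr do rewrite exprMn.
by rewrite big_split /= -expr_sum -mdegE hp.
Qed.

Lemma pihomog_top_neq0 n (R : nzRingType) (P : {mpoly R[n]}) :
  P != 0 -> pihomog mdeg (msize P).-1 P != 0.
Proof.
move=> P0; apply/eqP => /(congr1 (mcoeff (mlead P))).
have lP : mdeg (mlead P) = (msize P).-1 by rewrite -mlead_deg.
rewrite pihomogE raddf_sum /= big_mkcond (bigD1_seq (mlead P)) ?msupp_uniq ?mlead_supp
  //=.
rewrite lP eqxx mcoeffZ mcoeffX eqxx mulr1 big1 ?addr0 => [|m ne].
  by rewrite mcoeff0 => /eqP; rewrite mleadc_eq0 (negPf P0).
by case: ifP => // _; rewrite mcoeffZ mcoeffX (negPf ne) mulr0.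
Qed.

Definition alg_independent (F C : fieldType) (io : {rmorphism F -> C}) d
  (y : 'I_d -> C) := forall P : {mpoly F[d]}, mmap io y P = 0 -> P = 0.

Section NoetherNormalization.
Variables (F C : fieldType) (io : {rmorphism F -> C}).
Hypothesis F0 : [pchar F] =i pred0.

Lemma integral_mmap n (R : comNzRingType) (f : {rmorphism R -> C})
    (y : 'I_n -> C) (P : {mpoly F[n]}) :
  (forall c, integralOver f (io c)) -> (forall i, integralOver f (y i)) ->
  integralOver f (mmap io y P).
Proof.
move=> intc inty; rewrite /mmap.
have intsum (I : eqType) (s : seq I) (G : I -> C) :
    (forall i, integralOver f (G i)) -> integralOver f (\sum_(i <- s) G i).
  by move=> intG; elim/big_rec: _ => [|i x _]; [apply: integral0|apply: integral_add].
apply: intsum => m; apply: integral_mul => //.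
rewrite /mmap1; elim/big_rec: _ => [|i x _]; first exact: integral1.
apply: integral_mul; elim: (m i) => [|k IHk]; first exact: integral1.
by rewrite exprS; apply: integral_mul.
Qed.

Lemma integral_mmap_trans n k (y : 'I_n -> C) (y' : 'I_k -> C) x :
  (forall i, integralOver (mmap io y') (y i)) ->
  integralOver (mmap io y) x -> integralOver (mmap io y') x.
Proof.
move=> inty [N mN Nx].
apply: (@integral_root_monic _ _ _ _ (map_poly (mmap io y) N)) => //.
  exact: monic_map.
apply/integral_poly => i; rewrite coef_map; apply: integral_mmap => // c.
by rewrite -(mmapC y' io c); apply: integral_id.
Qed.

Lemma integral_dependent d (y : 'I_d.+1 -> C) P : P != 0 -> mmap io y P = 0 ->
  exists (B : 'I_d -> 'I_d.+1 -> F),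
    forall i, integralOver (mmap io (fun k => \sum_j io (B k j) * y j)) (y i).
Proof.
move=> P0 Py; have szP : (0 < msize P)%N by rewrite lt0n msize_poly_eq0.
set D := (msize P).-1; have szPD : (msize P <= D.+1)%N by rewrite prednK.
(* In a direction where the top homogeneous part does not vanish, [P] becomes monic up to the
   constant [a]. *)
have [la la_top] := mpoly_nonvanishing F0 (pihomog_top_neq0 P0).
pose a := (pihomog mdeg D P).@[la]; have {la_top} a0 : a != 0 := la_top.
have D0 : (0 < D)%N.
  rewrite lt0n; apply: contra P0 => /eqP D0; rewrite D0 in szPD.
  have PE := msize1_polyC szPD; move: Py; rewrite PE mmapC => /eqP.
  by rewrite fmorph_eq0 => /eqP ->.
have [l ll] : exists l, la l != 0.
  apply/existsP; apply: contraNT a0; rewrite negb_exists => /forallP la0.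
  have -> : a = 0 ^+ D * a.
    rewrite /a -(@mmap_homog_scale _ _ _ idfun) ?pihomogP //.
    by apply: eq_mmap => // i; rewrite mul0r; apply/eqP; rewrite -[_ == _]negbK.
  by rewrite expr0n gtn_eqF // mul0r.
(* The forms project [y] along [la] to the hyperplane where coordinate [l] is zero, so that [y] is
   this projection plus [T0] times [la]. *)
pose B k j : F := (j == lift l k)%:R - (la (lift l k) / la l) * (j == l)%:R.
exists B; pose y' k := \sum_j io (B k j) * y j; rewrite -/y'.
pose T0 := y l / io (la l).
have y'E k : y' k = y (lift l k) - io (la (lift l k)) * T0.
  rewrite /y' /B; under eq_bigr do rewrite rmorphB rmorphM !rmorph_nat mulrBl.
  rewrite sumrB (bigD1 (lift l k)) //= eqxx mul1r big1 => [|i /negPf ->]; last first.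
    by rewrite mul0r.
  rewrite (bigD1 l) //= eqxx big1 => [|i /negPf ->]; last by rewrite mulr0 mul0r.
  by rewrite !addr0 mulr1 /T0 fmorph_div mulrAC mulrA.
pose c i : {mpoly F[d]} := if unlift l i is Some k then 'X_k else 0.
(* [P] on that line, as a polynomial in the parameter; divided by [a], it is an integral equation
   for [T0]. *)
pose Q := mmap (@polyC _ \o @mpolyC d F)
  (fun i => (c i)%:P + ((la i)%:MP)%:P * 'X) P.
have [szQ Qtop] : has_top D (a%:MP) Q.
  have -> : a%:MP = mmap (@mpolyC d F) (fun i => (la i)%:MP) (pihomog mdeg D P).
    rewrite /a [meval _ _]/(mmap idfun la _) mmap_rmorph.
    by apply: eq_mmap.
  exact: has_top_linear_subst.
have QT0 : (map_poly (mmap io y') Q).[T0] = 0.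
  pose g : {rmorphism {poly {mpoly F[d]}} -> C} :=
    horner_eval T0 \o map_poly (mmap io y').
  rewrite -Py -[LHS]/(g Q) mmap_rmorph; apply: eq_mmap => [b|i].
    by rewrite /g /= /horner_eval map_polyC hornerC /= mmapC.
  rewrite /g /= /horner_eval rmorphD rmorphM /= map_polyX !map_polyC /= mmapC.
  rewrite hornerD hornerM hornerX !hornerC /c; case: unliftP => [k ->|->].
    by rewrite mmap_XU y'E subrK.
  by rewrite mmap0 add0r /T0 mulrC divfK // fmorph_eq0.
have intT0 : integralOver (mmap io y') T0.
  exists ((a^-1)%:MP *: Q).
    rewrite monicE lead_coefE.
    have cD : ((a^-1)%:MP *: Q)`_D = 1 by rewrite coefZ Qtop -rmorphM mulVf.
    suff -> : size ((a^-1)%:MP *: Q) = D.+1 by rewrite cD.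
    apply/eqP; rewrite eqn_leq (leq_trans (size_scale_leq _ _) szQ) ltnNge.
    by apply/negP => le; move/eqP: cD; rewrite nth_default // eq_sym oner_eq0.
  by rewrite /root map_polyZ hornerZ QT0 mulr0.
have intc b : integralOver (mmap io y') (io b).
  by rewrite -(mmapC y' io b); apply: integral_id.
move=> i; case: (unliftP l i) => [k ->|->].
  rewrite -[y _](subrK (io (la (lift l k)) * T0)) -y'E.
  apply: integral_add; last exact: integral_mul.
  by rewrite -(mmap_XU io y' k); apply: integral_id.
have -> : y l = io (la l) * T0 by rewrite /T0 mulrC divfK // fmorph_eq0.
exact: integral_mul.
Qed.

(** The [y k] are linear forms so that [x = 0] lies over [y = 0]. The recursion starts from [y = x],
    and each algebraic dependence removes one form. *)
Lemma noether_normalization p (x : 'I_p -> C) :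
  exists d (B : 'I_d -> 'I_p -> F), let y k := \sum_j io (B k j) * x j in
    alg_independent io y /\ forall i, integralOver (mmap io y) (x i).
Proof.
suff H d (B : 'I_d -> 'I_p -> F) :
    (forall i, integralOver (mmap io (fun k => \sum_j io (B k j) * x j)) (x i)) ->
    exists d (B : 'I_d -> 'I_p -> F), let y k := \sum_j io (B k j) * x j in
      alg_independent io y /\ forall i, integralOver (mmap io y) (x i).
  apply: (H p (fun k j => (j == k)%:R)) => i.
  set y := fun k => _; have -> : x i = mmap io y 'X_i.
    rewrite mmap_XU /y (bigD1 i) //= eqxx rmorph1 mul1r big1 ?addr0 // => j.
    by move/negPf => ->; rewrite rmorph0 mul0r.
  exact: integral_id.
elim: d B => [|d IHd] B intx; have [indep|dep] :=
    pselect (alg_independent io (fun k => \sum_j io (B k j) * x j)).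
- by exists 0%N, B.
- case: dep => P; rewrite /mmap => P0; apply/mpolyP => m.
  have m0 : m = 0%MM by apply/mnmP => -[].
  have PE : P = (P@_0)%:MP.
    apply: msize1_polyC; rewrite msizeE; apply/bigmax_leqP_seq => k _ _.
    by rewrite mdegE big_ord0.
  move: P0; rewrite PE -/(mmap io _ _) mmapC => /eqP; rewrite fmorph_eq0.
  by move=> /eqP ->; rewrite mpolyC0.
- by exists d.+1, B.
have [P [Py P0]] : exists P, mmap io (fun k => \sum_j io (B k j) * x j) P = 0 /\ P != 0.
  apply: contrapT => nP; apply: dep => P Py; apply/eqP; apply: contrapT => P0.
  by apply: nP; exists P; split=> //; apply/negP.
have [A intA] := integral_dependent P0 Py.
apply: (IHd (fun k j => \sum_i A k i * B i j)) => i.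
have -> : (fun k => \sum_j io (\sum_i A k i * B i j) * x j) =
    (fun k => \sum_i io (A k i) * (\sum_j io (B i j) * x j)).
  apply/funext => k; under eq_bigr do rewrite rmorph_sum mulr_suml.
  rewrite exchange_big; apply: eq_bigr => j _ /=; rewrite mulr_sumr.
  by apply: eq_bigr => e _; rewrite rmorphM mulrA.
exact: integral_mmap_trans intA (intx i).
Qed.

End NoetherNormalization.

(** * Integral elements over a polynomial ring *)

(* Leading monomials: [mlead q] divides [mlead p], so a multiple of [q] lowers
   [mlead p]. *)
Lemma almost_integral_dvd d (F : fieldType) (p q h : {mpoly F[d]}) :
  q != 0 -> h != 0 -> (forall k, exists r, h * p ^+ k = r * q ^+ k) ->
  exists r, p = r * q.
Proof.
move=> q0 h0; elim/mleadrect: p => p IHp aint.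
have [->|p0] := eqVneq p 0; first by exists 0; rewrite mul0r.
have lqp : (mlead q <= mlead p)%MM.
  (* The exponents of variable [i] are compared in [h * p ^ k = r * q ^ k]; with [k] above the
     exponent in [h], that factor cannot make up for a deficit of [p] against [q]. *)
  apply/mnm_lepP => i; have [r rE] := aint (mlead h i).+1.
  have r0 : r != 0.
    apply: contraTneq (mulf_neq0 h0 (expf_neq0 (mlead h i).+1 p0)) => r0.
    by rewrite rE r0 mul0r eqxx.
  have := congr1 (fun m : 'X_{1..d} => m i) (congr1 (@mlead _ _) rE).
  rewrite (mleadM h0 (expf_neq0 _ p0)) (mleadM r0 (expf_neq0 _ q0)).
  rewrite (mleadX _ p0) (mleadX _ q0) !mnmDE !mulmnE => eqi.
  rewrite leqNgt; apply/negP => lt.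
  by move: eqi lt; move: (mlead h i) (mlead p i) (mlead q i) (mlead r i) => a b c e; nia.
pose f := (p@_(mlead p) / q@_(mlead q)) *: 'X_[mlead p - mlead q].
pose p' := p - f * q.
have qc0 : q@_(mlead q) != 0 by rewrite mleadc_eq0.
have pc0 : p@_(mlead p) != 0 by rewrite mleadc_eq0.
have fc0 : p@_(mlead p) / q@_(mlead q) != 0 by rewrite mulf_neq0 ?invr_eq0.
have lf : mlead f = (mlead p - mlead q)%MM by rewrite mleadZ // mleadXm.
have f0 : f != 0 by rewrite -mleadc_eq0 lf mcoeffZ mcoeffX eqxx mulr1.
have lfq : mlead (f * q) = mlead p by rewrite mleadM // lf submK.
have p'c : p'@_(mlead p) = 0.
  rewrite mcoeffB -{2}lfq mleadM // mleadcM lf mcoeffZ mcoeffX eqxx mulr1.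
  by rewrite divfK // subrr.
have aint' k : exists r, h * p' ^+ k = r * q ^+ k.
  have /choice[r rE] := aint.
  exists (\sum_(i < k.+1) (r (k - i)%N * (- f) ^+ i) *+ 'C(k, i)).
  rewrite /p' -mulNr exprDn mulr_sumr mulr_suml; apply: eq_bigr => i _.
  have lei : (i <= k)%N by rewrite -ltnS.
  rewrite mulrnAr mulrnAl mulrA rE exprMn; congr (_ *+ _).
  have -> : q ^+ k = q ^+ (k - i) * q ^+ i by rewrite -exprD subnK.
  by ring.
have [p'0|p'0] := eqVneq p' 0.
  by exists f; apply/eqP; rewrite -subr_eq0 -/p' p'0.
have [|r rE] := IHp p' _ aint'.
  have le : (mlead p' <= mlead p)%O.
    by apply: le_trans (mleadB_le _ _) _; rewrite lfq joinxx.
  rewrite lt_neqAle le andbT; apply: contra_neq p'0 => eq_l.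
  by apply/eqP; rewrite -mleadc_eq0 eq_l p'c.
by exists (r + f); rewrite mulrDl -rE subrK.
Qed.

Section IntegrallyClosed.
Variables (F C : fieldType) (io : {rmorphism F -> C}) (d : nat) (y : 'I_d -> C).
Hypothesis indep : alg_independent io y.
Local Notation ev := (mmap io y).

Lemma ev_inj : injective ev.
Proof.
move=> a b eab; apply/eqP; rewrite -subr_eq0; apply/eqP/indep.
by rewrite mmapB eab subrr.
Qed.

(** By the integral equation, all powers of [x] are combinations over [F[y]] of the first [n]. So
    [q ^ n] is a common denominator of all of them, and [almost_integral_dvd] makes [q] divide
    [p]. *)
Lemma mpoly_integrally_closed (x : C) p q :
  q != 0 -> x = ev p / ev q -> integralOver ev x -> exists r, x = ev r.
Proof.
move=> q0 xE [N mN Nx].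
have evq0 : ev q != 0 by apply: contra_neq q0 => /indep.
pose n := size N.
have pw k : exists c : {poly {mpoly F[d]}}, (size c <= n)%N /\
    x ^+ k = (map_poly ev c).[x].
  exists (Pdiv.Ring.rmodp 'X^k N); split.
    by apply: ltnW; apply: Pdiv.Ring.ltn_rmodpN0; apply: monic_neq0.
  have := Pdiv.RingMonic.rdivp_eq mN 'X^k => /(congr1 (fun c => (map_poly ev c).[x])).
  rewrite map_polyXn hornerXn => ->.
  by rewrite rmorphD rmorphM hornerD hornerM (eqP Nx) mulr0 add0r.
have [|r pE] := @almost_integral_dvd _ _ p q (q ^+ n) q0 (expf_neq0 _ q0).
  move=> k; have [c [szc xk]] := pw k.
  exists (\sum_(i < n) c`_i * (q ^+ (n - i) * p ^+ i)); apply: ev_inj.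
  have -> : ev (q ^+ n * p ^+ k) = ev q ^+ n * x ^+ k * ev q ^+ k.
    by rewrite rmorphM !rmorphXn -mulrA -exprMn xE divfK.
  rewrite xk rmorphM rmorph_sum rmorphXn; congr (_ * _).
  rewrite (@horner_coef_wide _ n); last exact: leq_trans (leq_size_map_poly _ _) szc.
  rewrite mulr_sumr; apply: eq_bigr => i _; rewrite coef_map !rmorphM !rmorphXn /=.
  have -> : ev q ^+ n = ev q ^+ (n - i) * ev q ^+ i.
    by rewrite -exprD subnK // ltnW.
  have -> : ev p = ev q * x by rewrite xE mulrC divfK.
  by rewrite exprMn; ring.
by exists r; rewrite xE pE rmorphM mulfK.
Qed.

End IntegrallyClosed.

Lemma integral_prod_XsubC (R : comNzRingType) (C : fieldType)
    (f : {rmorphism R -> C}) (rs : seq C) :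
  (forall r, r \in rs -> integralOver f r) ->
  forall i, integralOver f (\prod_(r <- rs) ('X - r%:P))`_i.
Proof.
elim: rs => [|r rs IHrs] intrs i.
  by rewrite big_nil coef1 ; case: (i == 0%N); [apply: integral1|apply: integral0].
have {}IHrs := IHrs (fun s (sP : s \in rs) => intrs s (@mem_behead _ (r :: rs) s sP)).
rewrite big_cons mulrC mulrBr coefB coefMX coefMC.
apply: integral_sub; first by case: i => [|i]; [apply: integral0|apply: IHrs].
by apply: integral_mul => //; apply: intrs; rewrite mem_head.
Qed.

(** With coefficients in the finite set [s], there are finitely many polynomials of degree below
    [p]; [c] avoids the roots of all the non-zero ones. *)
Lemma separating_power (C : fieldType) p (s : seq C) : [pchar C] =i pred0 ->
  exists c : nat, forall phi : 'I_p -> C, (forall i, phi i \in s) ->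
    \sum_(i < p) c%:R ^+ i * phi i = 0 -> forall i, phi i = 0.
Proof.
move=> C0.
pose P (f : {ffun 'I_p -> 'I_(size s)}) : {poly C} := \poly_(i < p)
  (if insub i is Some j then s`_(f j) else 0).
have PE f c : (P f).[c] = \sum_(i < p) c ^+ i * s`_(f i).
  by rewrite horner_poly; apply: eq_bigr => i _; rewrite valK mulrC.
pose Q := \prod_(f | P f != 0) P f.
have Q0 : Q != 0 by apply/prodf_neq0.
have [c Qc] := natural_nonroot C0 Q0.
exists c => phi phis sum0 i.
have idx j : (index (phi j) s < size s)%N by rewrite index_mem.
pose f : {ffun 'I_p -> 'I_(size s)} := [ffun j => Ordinal (idx j)].
have fE j : s`_(f j) = phi j by rewrite ffunE nth_index.
have Pf0 : P f = 0.
  apply/eqP; apply: contraNT Qc => Pf0.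
  rewrite /Q (bigD1 f) //= rootM; apply/orP; left; rewrite rootE PE -[X in _ == X]sum0.
  by apply/eqP; apply: eq_bigr => j _; rewrite fE.
by have := congr1 (fun q : {poly C} => q`_i) Pf0; rewrite coef_poly ltn_ord valK /= fE
  coef0.
Qed.

(** * Arcs through a generic point *)

Section GenericPlace.
Variables (C : numClosedFieldType) (F : fieldType) (io : {rmorphism F -> C}).
Hypothesis enumF : enumerable F.
Hypothesis uncC : uncountable C.
Local Notation L := (laurent C).

Section InitialPlace.
Variables (d : nat) (y : 'I_d -> C).
Hypothesis indep : alg_independent io y.

(* The line through the origin with direction y, which is generic over F. *)
Definition generic_line : {rmorphism {mpoly F[d]} -> fps C} :=
  mmap (@fps_const C \o io) (fun i => fps_const (y i) * fps_z C).

(** The power of [z] records the degree, so injectivity of [generic_line] follows from independence,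
    one homogeneous component at a time. *)
Lemma generic_line_coef k P : generic_line P k = mmap io y (pihomog mdeg k P).
Proof.
have monomial e (a b : C) :
    (fps_const a * (fps_const b * fps_z C ^+ e)) k = if e == k then a * b else 0.
  rewrite mulrA -rmorphM mulrC fps_coef_zXM.
  have [ltke|ltek|->] := ltngtP e k => //=; last by rewrite subnn.
  by rewrite subn_eq0 leqNgt ltke.
rewrite pihomogE rmorph_sum big_mkcond.
rewrite -[generic_line P]/(mmap _ _ _) /mmap fps_coef_sum.
apply: eq_bigr => m _; rewrite -/(mmap io y _).
have -> : mmap1 (fun i => fps_const (y i) * fps_z C) m =
    fps_const (mmap1 y m) * fps_z C ^+ mdeg m.
  rewrite /mmap1; under eq_bigr do rewrite exprMn.
  rewrite big_split /= -expr_sum -mdegE rmorph_prod; congr (_ * _).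
  by apply: eq_bigr => i _; rewrite rmorphXn.
transitivity (if mdeg m == k then io P@_m * mmap1 y m else 0); first exact: monomial.
by case: ifP => // _; rewrite /= mmapZ mmapX.
Qed.

Lemma generic_line_inj P : generic_line P = 0 -> P = 0.
Proof.
move=> P0; rewrite (pihomog_partitionE (mf := mdeg) (leqnn (msize P))).
apply: big1 => k _; apply: indep.
by rewrite -generic_line_coef P0 fps_coef0.
Qed.

Lemma fps_ct_generic_line P : fps_ct (generic_line P) = io P.@[fun _ => 0].
Proof.
rewrite /generic_line /= mmap_rmorph [meval _ _]/(mmap idfun _ _) mmap_rmorph.
apply: eq_mmap => [c|i] //.
transitivity (fps_ct (fps_const (y i)) * fps_ct (fps_z C)); first exact: rmorphM.
by rewrite [fps_ct (fps_z C)]fps_ct_z mulr0 /= rmorph0.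
Qed.

Lemma initial_place : exists (P : place io) (j : {rmorphism {mpoly F[d]} -> P}),
  [/\ forall r, pl_in P (j r) = mmap io y r,
      forall r, pl_out P (j r) = (generic_line r)%:F &
      forall k, exists a b, b != 0 /\ k = j a / j b].
Proof.
have fg : compatible (mmap io y) (@FracField.tofrac (fps C) \o generic_line).
  move=> r; split=> [/indep ->|/= /eqP]; first by rewrite rmorph0.
  by rewrite tofrac_eq0 => /eqP /generic_line_inj ->; rewrite mmap0.
have [K [j [i [o [ij oj jfrac]]]]] := common_fraction_field fg.
have in_base x : i ((j \o @mpolyC d F) x) = io x by rewrite /= ij /= mmapC.
have out_base x : o ((j \o @mpolyC d F) x) = laurent_const (io x).
  by rewrite /= oj /= /generic_line /= mmapC.
have enumK : enumerable K.
  have eP := enumerable_mpoly d enumF.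
  apply: (enumerable_surj (f := fun x => j x.1 / j x.2)) (enumerable_pair eP eP).
  by move=> k; have [a [b ->]] := jfrac k; exists (a, b).
exists (Place in_base out_base enumK), j; split=> // k.
have [a [b kE]] := jfrac k; have [b0|b0] := eqVneq b 0; last by exists a, b.
by exists 0, 1; rewrite oner_neq0 kE b0 !rmorph0 invr0 mulr0 mul0r.
Qed.

End InitialPlace.

(** The hypothesis says that the origin lies in the Zariski closure of [x] over [F]; [ts] lists
    further numbers that the place must contain. *)
Theorem generic_place p (x : 'I_p -> C) (ts : seq C) :
    (forall P : {mpoly F[p]}, mmap io x P = 0 -> P.@[fun _ => 0] = 0) ->
  exists Q : place io, (forall t, t \in ts -> exists u, pl_in Q u = t) /\
    forall i u, pl_in Q u = x i -> exists2 a, fps_ct a = 0 & pl_out Q u = a%:F.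
Proof.
move=> x0.
have C0 : [pchar C] =i pred0 := pchar_num C.
have F0 : [pchar F] =i pred0.
  by move=> k; rewrite -(fmorph_pchar io) C0.
have [d [B [indep intx]]] := noether_normalization io F0 x.
set y := fun k => \sum_j _ in indep intx.
pose ev : {rmorphism {mpoly F[d]} -> C} := mmap io y.
have /choice[N NP] i : exists N : {poly {mpoly F[d]}},
    N \is monic /\ root (map_poly ev N) (x i).
  by have [N mN Nx] := intx i; exists N.
(* Evaluation at [y = 0], where [generic_line] starts. The constant term of the image of [x i] will
   be one of the finitely many roots [rt i] of the equation specialised there. *)
pose at0 : {rmorphism {mpoly F[d]} -> C} := io \o meval (fun _ => 0).
have /choice[rt rtP] i : exists s : seq C, forall c, root (map_poly at0 (N i)) c -> c
  \in s.
  apply: (@roots_in_seq _ _ idfun) => //.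
  by apply: monic_neq0; apply: monic_map; have [] := NP i.
have [c cP] := separating_power p (flatten [seq rt i | i <- enum 'I_p]) C0.
pose y' := \sum_(i < p) c%:R ^+ i * x i.
have [P0 [j [jin jout jfrac]]] := initial_place indep.
have j_inj : injective j.
  move=> a b /(congr1 (pl_in P0)); rewrite !jin; exact: (ev_inj indep).
have inty : integralOver ev y'.
  rewrite /y'; elim/big_rec: _ => [|i s _ ints]; first exact: integral0.
  apply: integral_add => //; apply: integral_mul => //.
  by rewrite -natrX; apply: integral_nat.
have [N' mN' N'y] := inty.
have map_in q : map_poly (pl_in P0) (map_poly j q) = map_poly ev q.
  by rewrite -map_poly_comp; apply: eq_map_poly => r; rewrite /= jin.
have jN0 : map_poly j N' != 0 by apply: monic_neq0; apply: monic_map.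
have jNy : root (map_poly (pl_in P0) (map_poly j N')) y' by rewrite map_in.
have [M [mM szM yM coM]] := minimal_polynomial jN0 jNy.
(* The coefficients of [M] lie in [F(y)], and they are integral over [F[y]] because every root of
   [M] is a root of [N']. *)
have /choice[r rE] i : exists r, M`_i = j r.
  have [a [b [b0 MiE]]] := jfrac M`_i.
  have inE : pl_in P0 M`_i = ev a / ev b by rewrite MiE fmorph_div !jin.
  have intMi : integralOver ev (pl_in P0 M`_i).
    have [rs rsE] := closed_field_poly_normal (map_poly (pl_in P0) M).
    have /monicP lM : map_poly (pl_in P0) M \is monic by apply: monic_map.
    rewrite -coef_map rsE lM scale1r; apply: integral_prod_XsubC => s sP.
    have Ms : root (map_poly (pl_in P0) M) s by rewrite rsE lM scale1r root_prod_XsubC.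
    exists N' => //; rewrite -map_in.
    have /dvdpP[q ->] : M %| map_poly j N' by apply/yM; rewrite map_in.
    by rewrite rmorphM rootM Ms orbT.
  have [r rE] := mpoly_integrally_closed indep b0 inE intMi.
  by exists r; apply: (fmorph_inj (pl_in P0)); rewrite jin.
pose Mt := \poly_(i < size M) r i.
have MtE : map_poly j Mt = M.
  apply/polyP => i; rewrite coef_map coef_poly /=; case: ltnP => [_|le].
    by rewrite rE.
  by rewrite rmorph0 nth_default.
have szMt : size Mt = size M by rewrite -MtE size_map_inj_poly // rmorph0.
have mMt : Mt \is monic.
  apply/monicP; apply: (j_inj); rewrite rmorph1.
  have /monicP := mM; rewrite -{1}MtE (lead_coef_map_inj j_inj (rmorph0 j)); apply.
(* Written in the [x i], the relation between [y'] and the forms [y] is one over [F], so it vanishes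
   at the origin by hypothesis. There [Y] and all the forms are zero, which leaves only this
   coefficient. *)
have Mt0 : (Mt`_0).@[fun _ => 0] = 0.
  pose evx : {rmorphism {mpoly F[p]} -> C} := mmap io x.
  pose m0 : {rmorphism {mpoly F[p]} -> F} := meval (fun _ => 0).
  pose sub : {rmorphism {mpoly F[d]} -> {mpoly F[p]}} :=
    mmap (@mpolyC p F) (fun k => \sum_i B k i *: 'X_i).
  pose Y : {mpoly F[p]} := \sum_(i < p) c%:R ^+ i * 'X_i.
  have evx_sub q : evx (sub q) = ev q.
    rewrite /sub /= mmap_rmorph; apply: eq_mmap => [b|k] /=; first by rewrite mmapC.
    by rewrite rmorph_sum; apply: eq_bigr => i _; rewrite /= mmapZ mmap_XU.
  have evxY : evx Y = y'.
    rewrite /Y rmorph_sum; apply: eq_bigr => i _.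
    by rewrite rmorphM rmorphXn rmorph_nat /= mmap_XU.
  have m0_sub q : m0 (sub q) = q.@[fun _ => 0].
    rewrite /sub /= mmap_rmorph [in RHS]/meval; apply: eq_mmap => [b|k] /=.
      by rewrite mevalC.
    by rewrite rmorph_sum big1 // => i _; rewrite /= mevalZ mevalXU mulr0.
  have m0Y : m0 Y = 0.
    by rewrite /Y rmorph_sum big1 // => i _; rewrite rmorphM /= mevalXU mulr0.
  have := x0 (map_poly sub Mt).[Y]; rewrite -/(evx _) -/(m0 _).
  rewrite -!horner_map evxY m0Y horner_coef0 !coef_map /= m0_sub; apply.
  rewrite -map_poly_comp (eq_map_poly (g := ev)) => [|q]; last exact: evx_sub.
  by rewrite -map_in MtE; apply/eqP/yM; apply: dvdpp.
(* The constant coefficient of [MS] vanishes at [z = 0], so that after ramification [MS] has a root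
   of positive order, the image chosen for [y']. *)
pose MS := map_poly (generic_line y) Mt.
have mMS : MS \is monic. by apply: monic_map.
have szMS : (1 < size MS)%N.
  rewrite size_map_poly_id0 ?szMt // (monicP mMt) rmorph1 oner_neq0 //.
have [|m m_gt0 [s sMS s0]] := puiseux_root_ct0 mMS szMS.
  by rewrite coef_map /= fps_ct_generic_line Mt0 rmorph0.
have [E EE] := expanding_exists C m_gt0.
have [|P1 P01 [u1 u1y u1s]] := place_adjoin_root (s := s%:F) m_gt0 EE yM coM.
  rewrite -MtE -map_poly_comp.
  rewrite (eq_map_poly (g := @FracField.tofrac _ \o (fps_expand m \o generic_line y))).
    by rewrite map_poly_comp map_poly_comp /root horner_map (eqP sMS) rmorph0.
  by move=> q; rewrite /= jout EE.
(* The other numbers are adjoined in any way: the image of [y'] already forces the constant terms of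
   all [x i] to vanish. *)
have [m2 m2_gt0 [Q P1Q Qts]] := place_adjoin_seq uncC P1 ([seq x i | i <- enum 'I_p] ++
  ts).
exists Q; split=> [t tP|]; first by apply: Qts; rewrite mem_cat tP orbT.
have [j2 [j2in j2out]] := P1Q; have [E2 EE2] := expanding_exists C m2_gt0.
have [j1 [j1in j1out]] := P01.
pose jj : {rmorphism {mpoly F[d]} -> Q} := j2 \o (j1 \o j).
have jj_in q : pl_in Q (jj q) = ev q by rewrite /jj /= j2in j1in jin.
pose hh : {rmorphism {mpoly F[d]} -> fps C} :=
  fps_expand m2 \o (fps_expand m \o generic_line y).
have jj_out q : pl_out Q (jj q) = (hh q)%:F.
  by rewrite /jj /= (j2out _ EE2) (j1out _ EE) jout EE EE2.
have /choice[w wx] i : exists u, pl_in Q u = x i.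
  by apply: Qts; rewrite mem_cat map_f ?mem_enum.
have Nw i : root (map_poly (@FracField.tofrac _) (map_poly hh (N i))) (pl_out Q (w i)).
  have [mNi Nxi] := NP i.
  rewrite -map_poly_comp (eq_map_poly (g := pl_out Q \o jj)) => [|q]; last first.
    by rewrite /= jj_out.
  rewrite map_poly_comp /root horner_map fmorph_eq0.
  rewrite -(fmorph_eq0 (pl_in Q)) -horner_map -map_poly_comp wx.
  by rewrite (eq_map_poly (g := ev)).
have /choice[a aw] i : exists a, pl_out Q (w i) = a%:F.
  by apply: fps_integrally_closed (Nw i); apply: monic_map; have [] := NP i.
have a_rt i : fps_ct (a i) \in rt i.
  apply: rtP; have [mNi Nxi] := NP i.
  have ct_hh q : fps_ct (hh q) = at0 q.
    rewrite -[LHS]/(fps_ct (fps_expand m2 (fps_expand m (generic_line y q)))).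
    by rewrite !fps_ct_expand fps_ct_generic_line.
  have Na : (map_poly hh (N i)).[a i] = 0.
    have := Nw i; rewrite aw /root horner_map => /eqP/eqP.
    by rewrite tofrac_eq0 => /eqP.
  have := congr1 (@fps_ct C) Na; rewrite -horner_map -map_poly_comp.
  by rewrite (eq_map_poly (g := at0)) // rmorph0 => /eqP.
have suma : \sum_(i < p) c%:R ^+ i * fps_ct (a i) = 0.
  have u1w : j2 u1 = \sum_(i < p) c%:R ^+ i * w i.
    apply: (fmorph_inj (pl_in Q)); rewrite j2in u1y rmorph_sum.
    by apply: eq_bigr => i _; rewrite rmorphM rmorphXn rmorph_nat wx.
  have : (fps_expand m2 s)%:F = (\sum_(i < p) c%:R ^+ i * a i)%:F.
    rewrite -EE2 -u1s -(j2out _ EE2) u1w !rmorph_sum; apply: eq_bigr => i _.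
    by rewrite !rmorphM !rmorphXn !rmorph_nat /= aw.
  move=> /eqP; rewrite tofrac_eq => /eqP /(congr1 (@fps_ct C)).
  rewrite fps_ct_expand s0 rmorph_sum => eq0; apply: etrans (esym eq0); apply: eq_bigr
    => i _.
  by rewrite rmorphM rmorphXn rmorph_nat.
have a0 := cP (fun i => fps_ct (a i)) _ suma.
move=> i u ux; have -> : u = w i by apply: (fmorph_inj (pl_in Q)); rewrite wx.
exists (a i) => //; apply: a0 => k; apply/flattenP; exists (rt k) => //.
by rewrite map_f ?mem_enum.
Qed.

End GenericPlace.

(** * A Nullstellensatz avoiding countably many hypersurfaces *)

Section CountableNullstellensatz.
Variables (C : numClosedFieldType) (N : nat).
Local Notation A := {mpoly C[N]}.
Implicit Types (I : A -> Prop) (p t : A).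
Hypothesis uncC : uncountable C.

Record ideal I : Prop := Ideal {
  ideal0 : I 0;
  idealD : forall a b, I a -> I b -> I (a + b);
  idealMl : forall a b, I b -> I (a * b)
}.

Lemma idealB I a b : ideal I -> I a -> I b -> I (a - b).
Proof.
by move=> idI Ia Ib; apply: idealD => //; rewrite -mulN1r; apply: idealMl.
Qed.

Lemma ideal_sum I n (f : 'I_n -> A) : ideal I -> (forall i, I (f i)) -> I (\sum_i f i).
Proof.
move=> idI If; elim/big_rec: _ => [|i x _ Ix]; first exact: ideal0.
exact: idealD.
Qed.

(** Applied to the fibres of a map from [C] to a countable set: they cannot all be finite, and one
    that is not has subsets larger than any given dimension. *)
Lemma finite_or_large (T : eqType) (P : T -> Prop) :
  (exists s : seq T, forall c, P c -> c \in s) \/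
  forall m, exists s : seq T, [/\ uniq s, size s = m & forall c, c \in s -> P c].
Proof.
have [fin|inf] := pselect (exists s : seq T, forall c, P c -> c \in s); first by left.
right; elim=> [|m [s [us szs Ps]]]; first by exists [::].
have [c [Pc cs]] : exists c, P c /\ c \notin s.
  apply: contrapT => nc; apply: inf; exists s => c Pc; apply: contrapT => ncs.
  by apply: nc; exists c; split=> //; apply/negP.
exists (c :: s); split=> /=; rewrite ?cs ?szs // => c'.
by rewrite inE => /orP[/eqP ->|/Ps].
Qed.

Lemma linear_dependence n m (f : 'I_m -> A) : (#|{: 'X_{1..N < n}}| < m)%N ->
  (forall i, (msize (f i) <= n)%N) ->
  exists la : 'I_m -> C, (exists i, la i != 0) /\ \sum_i la i *: f i = 0.
Proof.
move=> ltm szf; pose M := \matrix_(i < m, k < #|{: 'X_{1..N < n}}|)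
  (f i)@_(bmnm (enum_val k)).
have kM0 : kermx M != 0.
  rewrite -mxrank_eq0 mxrank_ker subn_eq0 -ltnNge.
  by apply: leq_ltn_trans ltm; apply: rank_leq_col.
have /rowV0Pn[v /sub_kermxP vM v0] := kM0.
exists (fun i => v 0 i); split.
  by have /rV0Pn[i vi] := v0; exists i.
apply/mpolyP => m0; rewrite mcoeff0 raddf_sum /=.
under eq_bigr do rewrite mcoeffZ.
have [ltm0|lem0] := ltnP (mdeg m0) n; last first.
  apply: big1 => i _; rewrite memN_msupp_eq0 ?mulr0 //.
  by apply: msize_mdeg_ge; apply: leq_trans (szf i) lem0.
have := congr1 (fun B : 'rV_#|{: 'X_{1..N < n}}| =>
  B 0 (enum_rank (BMultinom ltm0))) vM.
rewrite mxE [in RHS]mxE => sum0; rewrite -[RHS]sum0; apply: eq_bigr => i _.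
by rewrite mxE enum_rankK.
Qed.

Section Specialization.
Variables (S : nat -> A).
Hypothesis S1 : exists k, S k = 1.
Hypothesis SM : forall i j, exists k, S k = S i * S j.

Definition avoids I := forall k, ~ I (S k).

(* If every [t - c] were excluded, uncountably many [c] would share the same [S k]
   with cofactors of bounded degree; a linear relation between these cofactors
   gives [S k * q(t)] in [I] for a nonzero [q], and [q] splits. *)
Lemma ideal_specialize I t : ideal I -> avoids I ->
  exists c : C, avoids (fun p => exists h, I (p - (t - c%:MP) * h)).
Proof.
move=> idI avI; apply: contrapT => noc.
have /choice[k /choice[h khP]] (c : C) : exists k h, I (S k - (t - c%:MP) * h).
  apply: contrapT => nk; apply: noc; exists c => k [h Ih].
  by apply: nk; exists k, h.
pose fib (n : nat * nat) c := k c = n.1 /\ (msize (h c) <= n.2)%N.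
have [n large] : exists n, forall m, exists s : seq C,
    [/\ uniq s, size s = m & forall c, c \in s -> fib n c].
  apply: contrapT => small.
  have /choice[e eP] (n : nat * nat) : exists s : seq C, forall c, fib n c -> c \in s.
    have [//|large] := finite_or_large (fib n).
    by case: small; exists n.
  have [g gP] := enumerable_countType (0%N, 0%N).
  have [c ce] := uncC (e \o g).
  have [i gi] := gP (k c, msize (h c)).
  by have /negP[] := ce i; rewrite /= gi; apply: eP.
have [s [us szs sP]] := large (#|{: 'X_{1..N < n.2}}|.+1).
pose m := size s; pose c (i : 'I_m) := s`_i.
have cfib i : fib n (c i) by apply: sP; rewrite mem_nth.
have c_inj i j : c i = c j -> i = j.
  by move=> /eqP; rewrite nth_uniq // => /eqP /val_inj.
have [||la [[i0 la0] sum0]] := @linear_dependence n.2 m (h \o c).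
- by rewrite /m szs.
- by move=> i; have [] := cfib i.
pose w : {rmorphism {poly C} -> A} := horner_eval t \o map_poly (@mpolyC N C).
have wX b : w ('X - b%:P) = t - b%:MP.
  by rewrite /w /= /horner_eval rmorphB /= map_polyX map_polyC !hornerE.
have wC b : w b%:P = b%:MP by rewrite /w /= /horner_eval map_polyC hornerC.
(* The multipliers that make the cofactors cancel. At [c i0] only the term of [i0] survives, whence
   [q != 0]. *)
pose q := \sum_i (la i)%:P * \prod_(j | j != i) ('X - (c j)%:P).
have q0 : q != 0.
  apply/eqP => /(congr1 (horner^~ (c i0))); rewrite horner0 horner_sum (bigD1 i0) //=.
  rewrite [X in _ + X]big1 ?addr0 => [|i ii0]; last first.
    by rewrite hornerM horner_prod (bigD1 i0) 1?eq_sym //= hornerXsubC subrr mul0r mulr0.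
  apply/eqP; rewrite hornerM hornerC mulf_neq0 // horner_prod.
  by apply/prodf_neq0 => j ji; rewrite hornerXsubC subr_eq0; apply: contra_neq ji =>
    /c_inj.
have Isq : I (S n.1 * w q).
  have -> : S n.1 * w q = \sum_i (la i)%:MP * \prod_(j | j != i) (t - (c j)%:MP) *
      (S (k (c i)) - (t - (c i)%:MP) * h (c i)).
    rewrite /q rmorph_sum mulr_sumr.
    under [RHS]eq_bigr => i _ do rewrite mulrBr.
    rewrite sumrB [X in _ - X](_ : _ = 0) ?subr0.
      apply: eq_bigr => i _; rewrite rmorphM wC rmorph_prod; have [-> _] := cfib i.
      by under eq_bigr do rewrite wX; rewrite mulrC.
    transitivity (\prod_j (t - (c j)%:MP) * \sum_i la i *: (h \o c) i); last first.
      by rewrite sum0 mulr0.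
    rewrite mulr_sumr; apply: eq_bigr => i _.
    by rewrite [in RHS](bigD1 i) //= -mul_mpolyC; ring.
  by apply: ideal_sum => // i; apply: idealMl.
(* A linear factor [t - z] can be exchanged for [S (k z)], which is a multiple of it modulo [I]. *)
have reduce (rs : seq C) g : I (g * \prod_(z <- rs) (t - z%:MP)) -> exists k, I (g * S k).
  elim: rs g => [|z rs IHrs] g.
    by rewrite big_nil mulr1 => Ig; have [k1 k1E] := S1; exists k1; rewrite k1E mulr1.
  rewrite big_cons => Ig; have [|k' Ik'] := IHrs (g * S (k z)).
    have -> : g * S (k z) * \prod_(z0 <- rs) (t - z0%:MP) =
      g * \prod_(z0 <- rs) (t - z0%:MP) * (S (k z) - (t - z%:MP) * h z) +
      h z * (g * ((t - z%:MP) * \prod_(z0 <- rs) (t - z0%:MP))) by ring.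
    by apply: idealD => //; apply: idealMl.
  by have [k2 k2E] := SM (k z) k'; exists k2; rewrite k2E mulrA.
have [rs rsE] := closed_field_poly_normal q.
have l0 : lead_coef q != 0 by rewrite lead_coef_eq0.
have wq : w q = (lead_coef q)%:MP * \prod_(z <- rs) (t - z%:MP).
  rewrite [X in w X = _]rsE -mul_polyC rmorphM wC rmorph_prod; congr (_ * _).
  by apply: eq_bigr => z _; rewrite wX.
have [|k' Ik'] := reduce rs (S n.1).
  have -> : S n.1 * \prod_(z <- rs) (t - z%:MP) =
      ((lead_coef q)^-1)%:MP * (S n.1 * w q).
    by rewrite wq mulrCA; congr (_ * _); rewrite mulrA -mpolyCM mulVf // mul1r.
  exact: idealMl.
have [k2 k2E] := SM n.1 k'; apply: (avI k2).
by rewrite k2E.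
Qed.

Lemma ideal_specialize_seq I (ts : seq A) : ideal I -> avoids I ->
  exists J : A -> Prop, [/\ ideal J, avoids J, forall p, I p -> J p &
    forall t, t \in ts -> exists c : C, J (t - c%:MP)].
Proof.
move=> idI avI; elim: ts => [|t ts [J [idJ avJ IJ Jts]]]; first by exists I.
have [c avc] := ideal_specialize t idJ avJ.
exists (fun p => exists h, J (p - (t - c%:MP) * h)); split=> //.
- split; first by exists 0; rewrite mulr0 subr0; apply: ideal0.
  + move=> a b [h Ja] [g Jb]; exists (h + g).
    by rewrite mulrDr opprD addrACA; apply: idealD.
  + move=> a b [h Jb]; exists (a * h).
    by rewrite mulrCA -mulrBr; apply: idealMl.
- by move=> p /IJ Jp; exists 0; rewrite mulr0 subr0.
move=> t'; rewrite inE => /orP[/eqP->|/Jts[b Jb]].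
  by exists c, 1; rewrite mulr1 subrr; apply: ideal0.
by exists b, 0; rewrite mulr0 subr0.
Qed.

(** The variables are specialised one at a time while the growing ideal keeps avoiding the whole
    family [S]; in the end each polynomial is congruent to its value at [c]. *)
Theorem countable_nullstellensatz I : ideal I -> avoids I ->
  exists c : 'I_N -> C, (forall p, I p -> p.@[c] = 0) /\ forall k, (S k).@[c] != 0.
Proof.
move=> idI avI; have [J [idJ avJ IJ JX]] := ideal_specialize_seq [seq 'X_i | i <- enum
  'I_N] idI avI.
have /choice[c cP] i : exists c : C, J ('X_i - c%:MP).
  by apply: JX; apply/mapP; exists i; rewrite ?mem_enum.
have Jp p : J (p - (p.@[c])%:MP).
  have JM a b a' b' : J (a - b) -> J (a' - b') -> J (a * a' - b * b').
    move=> Ja Jb; have -> : a * a' - b * b' = a' * (a - b) + b * (a' - b') by ring.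
    by apply: idealD => //; apply: idealMl.
  elim/mpolyind: p => [|b m p _ _ IHp]; first by rewrite mevalC mpolyC0 subrr; apply:
    ideal0.
  rewrite mevalD mpolyCD opprD addrACA; apply: idealD => //.
  rewrite mevalZ mpolyCM -mul_mpolyC -mulrBr; apply: (idealMl idJ).
  rewrite mevalX mpolyXE_id rmorph_prod.
  elim/big_rec2: _ => [|i a b' _ IH]; first by rewrite subrr; apply: ideal0.
  apply: (JM) => //; elim: (m i) => [|e IHe]; first by rewrite subrr; apply: ideal0.
  by rewrite !exprS rmorphM; apply: (JM).
have notJ1 : ~ J 1 by move=> J1; have [k Sk] := S1; apply: (avJ k); rewrite Sk.
exists c; split=> [p /IJ Jpp|k]; last first.
  by apply/eqP => Sk0; apply: (avJ k); have := Jp (S k); rewrite Sk0 mpolyC0 subr0.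
apply: contrapT => /eqP pc0; apply: notJ1.
have -> : 1 = ((p.@[c])^-1)%:MP * (p - (p - (p.@[c])%:MP)) :> A.
  by rewrite subKr -mpolyCM mulVf.
by apply: idealMl => //; apply: idealB.
Qed.

End Specialization.
End CountableNullstellensatz.

(** * Countable fields of definition *)

Section CountableSubfield.
Variables (C : fieldType) (a : nat -> seq C).

(** Every stage is a finite sequence, which makes the union enumerable. *)
Fixpoint subfield_stage n : seq C :=
  if n is n'.+1 then
    let s := subfield_stage n' in
    a n' ++ s ++ [seq x - y | x <- s, y <- s] ++ [seq x / y | x <- s, y <- s]
  else [:: 1].

Definition generated_subfield : {pred C} :=
  [pred x | `[< exists n, x \in subfield_stage n >] ].

Lemma generated_subfieldP x :
  reflect (exists n, x \in subfield_stage n) (x \in generated_subfield).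
Proof. exact: asboolP. Qed.

Lemma subfield_stage_homo n m x : (n <= m)%N ->
  x \in subfield_stage n -> x \in subfield_stage m.
Proof.
move=> lenm xn; rewrite -(subnK lenm); elim: (m - n)%N => [|k IHk] //.
by rewrite addSn /= !mem_cat IHk orbT.
Qed.

Lemma generated_subfield_divring_closed : divring_closed generated_subfield.
Proof.
split; first by apply/generated_subfieldP; exists 0%N; rewrite mem_head.
- move=> x y /generated_subfieldP[n xn] /generated_subfieldP[m ym].
  apply/generated_subfieldP; exists (maxn n m).+1; rewrite /= !mem_cat.
  rewrite (allpairs_f (fun x y => x - y)) ?orbT //.
    exact: subfield_stage_homo (leq_maxl n m) xn.
  exact: subfield_stage_homo (leq_maxr n m) ym.
move=> x y /generated_subfieldP[n xn] /generated_subfieldP[m ym].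
apply/generated_subfieldP; exists (maxn n m).+1; rewrite /= !mem_cat.
rewrite (allpairs_f (fun x y => x / y)) ?orbT //.
  exact: subfield_stage_homo (leq_maxl n m) xn.
exact: subfield_stage_homo (leq_maxr n m) ym.
Qed.

HB.instance Definition _ := GRing.isDivringClosed.Build C
  generated_subfield generated_subfield_divring_closed.

Record subfield_type :=
  SubfieldType { subfield_val : C; _ : subfield_val \in generated_subfield }.

HB.instance Definition _ := [isSub for subfield_val].
HB.instance Definition _ := [Choice of subfield_type by <:].
HB.instance Definition _ := [SubChoice_isSubIntegralDomain of subfield_type by <:].
HB.instance Definition _ := [SubIntegralDomain_isSubField of subfield_type by <:].

Lemma countable_subfield : exists (F : fieldType) (io : {rmorphism F -> C}),
  enumerable F /\ forall n x, x \in a n -> exists y, io y = x.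
Proof.
exists subfield_type, \val; split.
  apply: (@enumerable_surj (nat * nat)%type _
    (fun n => insubd (1 : subfield_type) (subfield_stage n.1)`_n.2)).
    move=> x; have /generated_subfieldP[n xn] := valP x.
    exists (n, index (val x) (subfield_stage n)); rewrite /= nth_index //.
    by rewrite valKd.
  exact: (@enumerable_countType _ (0%N, 0%N)).
move=> n x xn; have xF : x \in generated_subfield.
  by apply/generated_subfieldP; exists n.+1; rewrite /= mem_cat xn.
by exists (SubfieldType xF).
Qed.

End CountableSubfield.

Lemma mpoly_descent (F C : fieldType) (io : {rmorphism F -> C}) n (p : {mpoly C[n]}) :
  (forall m, exists x, io x = p@_m) -> exists q, map_mpoly io q = p.
Proof.
move=> /choice[x xE]; exists (\sum_(m <- msupp p) x m *: 'X_[m]).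
rewrite rmorph_sum [RHS]mpolyE; apply: eq_bigr => m _.
by rewrite /= map_mpolyZ map_mpolyX xE.
Qed.

(** * Countable spanning families for spaces of polynomials *)

Section Spanning.
Variables (C : fieldType) (N : nat).
Local Notation A := {mpoly C[N]}.
Variable U : A -> Prop.
Hypotheses (U0 : U 0) (UD : forall a b, U a -> U b -> U (a + b))
  (UZ : forall c a, U a -> U (c *: a)).

Section BoundedDegree.
Variable n : nat.
Local Notation m := #|{: 'X_{1..N < n}}|.

Definition rV_mpoly (v : 'rV[C]_m) : A := \sum_k v 0 k *: 'X_[bmnm (enum_val k)].

Lemma rV_mpoly_is_linear : linear rV_mpoly.
Proof.
move=> c u v; rewrite /rV_mpoly scaler_sumr -big_split; apply: eq_bigr => k _.
by rewrite /= !mxE scalerDl scalerA.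
Qed.

HB.instance Definition _ := GRing.isLinear.Build C 'rV[C]_m A _ rV_mpoly
  rV_mpoly_is_linear.

Lemma rV_mpoly_surj p : (msize p <= n)%N -> exists v, rV_mpoly v = p.
Proof.
move=> szp; exists (\row_k p@_(bmnm (enum_val k))).
rewrite [RHS](mpolywE szp) /rV_mpoly (reindex (@enum_rank {: 'X_{1..N < n}})) /=.
  by apply: eq_bigr => k _; rewrite mxE enum_rankK.
by exists enum_val => k _; [apply: enum_rankK | apply: enum_valK].
Qed.

Lemma rV_mpoly_mulmx k (M : 'M[C]_(k, m)) v :
  rV_mpoly (v *m M) = \sum_i v 0 i *: rV_mpoly (row i M).
Proof.
by rewrite mulmx_sum_row linear_sum; apply: eq_bigr => i _; rewrite linearZ.
Qed.

Lemma U_sum k (f : 'I_k -> A) : (forall i, U (f i)) -> U (\sum_i f i).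
Proof. by move=> Uf; elim/big_rec: _ => // i x _; apply: UD. Qed.

(** Rows in [U] of greatest possible rank: an element of [U] outside their span would raise it. *)
Lemma spanning_matrix : exists M : 'M[C]_m, (forall i, U (rV_mpoly (row i M))) /\
  forall v, U (rV_mpoly v) -> (v <= M)%MS.
Proof.
pose P r := `[< exists M : 'M[C]_m, (forall i, U (rV_mpoly (row i M))) /\ \rank M = r >].
have P0 : exists r, P r.
  by exists 0%N; apply/asboolP; exists 0; rewrite mxrank0; split=> // i; rewrite row0
    linear0.
have Pm r : P r -> (r <= m)%N by move/asboolP => [M [_ <-]]; apply: rank_leq_row.
case: (ex_maxnP P0 Pm) => r /asboolP[M [UM rM]] rmax.
exists M; split=> // v Uv.
have : (\rank (M + v)%MS <= r)%N.
  apply: rmax; apply/asboolP; exists (M + v)%MS; split=> // i.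
  have /sub_addsmxP[[x y] /= ->] : (row i (M + v)%MS <= M + v)%MS by apply: row_sub.
  rewrite linearD /=; apply: UD; rewrite rV_mpoly_mulmx; apply: U_sum => k.
    exact: UZ.
  by rewrite row_id; apply: UZ.
rewrite -rM => le; apply: submx_trans (addsmxSr M v) _.
have : (M <= M + v)%MS by apply: addsmxSl.
by move/mxrank_leqif_sup => /leqifP; case: ifP => // _; rewrite ltnNge le.
Qed.

End BoundedDegree.

Lemma countable_spanning : exists e : nat -> A, (forall k, U (e k)) /\
  forall p, U p -> exists s : seq (C * nat), p = \sum_(x <- s) x.1 *: e x.2.
Proof.
have /choice[G GP] n : exists e : nat -> A, (forall k, U (e k)) /\
    forall p, U p -> (msize p <= n)%N ->
    exists s : seq (C * nat), p = \sum_(x <- s) x.1 *: e x.2.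
  have [M [UM Mspan]] := spanning_matrix n.
  exists (fun k => if insub k is Some i then rV_mpoly (row i M) else 0).
  split=> [k|p Up szp]; first by case: insubP.
  have [v vp] := rV_mpoly_surj szp.
  have /submxP[w wE] : (v <= M)%MS by apply: Mspan; rewrite vp.
  exists [seq (w 0 i, val i) | i <- enum 'I_#|{: 'X_{1..N < n}}|].
  rewrite big_map /= big_enum /= -vp wE rV_mpoly_mulmx; apply: eq_bigr => i _.
  by rewrite valK.
exists (fun k => if unpickle k is Some nk then G nk.1 nk.2 else 0).
split=> [k|p Up].
  by case: (unpickle k) => [nk|] //; have [] := GP nk.1.
have [_ span] := GP (msize p); have [s ->] := span p Up (leqnn _).
exists [seq (x.1, pickle (msize p, x.2)) | x <- s].
by rewrite big_map /=; apply: eq_bigr => x _; rewrite pickleK.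
Qed.

End Spanning.

(** Nested intervals: each step passes to a subinterval that misses the next value, and the supremum
    of the left ends lies in all of them. *)
Lemma real_uncountable (R : realType) (f : nat -> R) : exists x, forall n, f n != x.
Proof.
pose third (ab : R * R) := (ab.2 - ab.1) / 3%:R.
(* In the second case [x] may be the point one third of the way, so the right end stops at half of
   that. *)
pose step x (ab : R * R) : R * R :=
  if x < ab.1 + third ab then (ab.1 + third ab, ab.2) else (ab.1, ab.1 + third ab / 2%:R).
pose g := fix g n := if n is n'.+1 then step (f n') (g n') else (0, 1) : R * R.
have stepP x ab : ab.1 < ab.2 ->
    [/\ ab.1 <= (step x ab).1, (step x ab).1 < (step x ab).2, (step x ab).2 <= ab.2 &
    (x < (step x ab).1) || ((step x ab).2 < x)].
  case: ab => a b /= ab; rewrite /step /third /=.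
  have t0 : 0 < (b - a) / 3%:R by rewrite divr_gt0 ?subr_gt0 // ltr0n.
  have tE : b = a + (b - a) / 3%:R * 3%:R by rewrite divfK ?pnatr_eq0 // addrC subrK.
  set t := _ / _ in t0 tE *; clearbody t; subst b.
  by case: ltP => h /=; split; lra.
have glt n : (g n).1 < (g n).2.
  by elim: n => [|n IHn] /=; [lra|have [] := stepP (f n) (g n) IHn].
have ghomo n k : (g n).1 <= (g (n + k)%N).1 /\ (g (n + k)%N).2 <= (g n).2.
  elim: k => [|k [IH1 IH2]]; first by rewrite addn0.
  rewrite addnS /=; have [h1 _ h2 _] := stepP (f (n + k)%N) _ (glt (n + k)%N).
  by split; [apply: le_trans IH1 h1|apply: le_trans h2 IH2].
have gub n k : (g n).1 <= (g k).2.
  have [h1 _] := ghomo n k; have [_ h2] := ghomo k n.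
  rewrite addnC in h2; apply: le_trans h1 (le_trans (ltW (glt _)) h2).
pose E : set R := [set (g n).1 | n in setT]%classic.
have E0 : (E !=set0)%classic by exists (g 0%N).1, 0%N.
have Eub k : ubound E (g k).2 by move=> _ [n _ <-].
exists (sup E) => n; apply/eqP => fn.
have supE : has_sup E by split=> //; exists (g 0%N).2.
have up k : (g k).1 <= sup E by apply: ub_le_sup; [exists (g 0%N).2|exists k].
have lo k : sup E <= (g k).2 by apply: ge_sup.
have [_ _ _ /orP[]] := stepP (f n) _ (glt n).
  by rewrite fn; have := up n.+1; rewrite /= leNgt fn => /negP.
by rewrite fn; have := lo n.+1; rewrite /= leNgt fn => /negP.
Qed.

Lemma complex_uncountable (R : realType) : uncountable R[i].
Proof.
move=> e; have [f fP] := enumerable_countType (0%N, 0%N).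
have [x xP] := real_uncountable (fun n => complex.Re (nth 0 (e (f n).1) (f n).2)).
exists (x%:C)%C => n; apply/negP => xn.
have [k kE] := fP (n, index (x%:C)%C (e n)).
by have /eqP := xP k; rewrite kE /= nth_index.
Qed.

(** * Linear algebraic groups and semistability *)

Lemma meval_mmap n k (F S : comNzRingType) (f : {rmorphism F -> S})
    (h : 'I_n -> {mpoly S[k]}) (v : 'I_k -> S) (p : {mpoly F[n]}) :
  (mmap (@mpolyC k S \o f) h p).@[v] = mmap f (fun i => (h i).@[v]) p.
Proof.
by rewrite (mmap_rmorph _ _ (meval v)); apply: eq_mmap => [c|i] //=; rewrite mevalC.
Qed.

Lemma map_mpoly_eval n (R S : comNzRingType) (f : {rmorphism R -> S})
    (h : 'I_n -> S) (p : {mpoly R[n]}) : (map_mpoly f p).@[h] = mmap f h p.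
Proof. by rewrite meval_mmap; apply: eq_mmap => i //; rewrite mevalXU. Qed.

Lemma dhomog_subst n k (R : comNzRingType) (S : nzRingType) (f : S -> R)
    (h : 'I_n -> {mpoly R[k]}) (P : {mpoly S[n]}) d :
  (forall i, h i \is 1.-homog) -> P \is d.-homog ->
  mmap (@mpolyC k R \o f) h P \is d.-homog.
Proof.
move=> hh /dhomogP hP; rewrite /mmap big_seq; apply: rpred_sum => m mP.
rewrite mul_mpolyC; apply: rpredZ; have <- : mdeg m = d := hP m mP.
rewrite mdegE /mmap1.
elim/big_rec2: _ => [|i x e _ IH]; first exact: dhomog1.
by apply: dhomogM IH; have := dhomogMn (m i) (hh i); rewrite mul1n.
Qed.

Section GLCoordinates.
Variable n : nat.

Definition gl_index (i j : 'I_n) : 'I_(n * n + 1) := lshift 1 (mxvec_index i j).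
Definition gl_last : 'I_(n * n + 1) := rshift (n * n) ord0.

Lemma gl_coordE (K : fieldType) (g : 'M[K]_n) i j : gl_coord g (gl_index i j) = g i j.
Proof. by rewrite /gl_coord row_mxEl mxvecE. Qed.

Lemma gl_coord_last (K : fieldType) (g : 'M[K]_n) : gl_coord g gl_last = (\det g)^-1.
Proof. by rewrite /gl_coord row_mxEr mxE. Qed.

Lemma gl_indexP (P : 'I_(n * n + 1) -> Prop) :
  (forall i j, P (gl_index i j)) -> P gl_last -> forall k, P k.
Proof.
move=> Pij Pl k; case: (split_ordP k) => [l ->|l ->]; last by rewrite ord1.
by case/mxvec_indexP: l => i j; apply: Pij.
Qed.

Definition gl_matrix (R : Type) (c : 'I_(n * n + 1) -> R) : 'M[R]_n :=
  \matrix_(i, j) c (gl_index i j).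

Lemma gl_matrix_map (R S : Type) (f : R -> S) (c : 'I_(n * n + 1) -> R) :
  gl_matrix (f \o c) = map_mx f (gl_matrix c).
Proof. by apply/matrixP => i j; rewrite !mxE. Qed.

Lemma gl_coordK (K : fieldType) (g : 'M[K]_n) : gl_matrix (gl_coord g) = g.
Proof. by apply/matrixP => i j; rewrite mxE gl_coordE. Qed.

Lemma gl_matrixK (K : fieldType) (c : 'I_(n * n + 1) -> K) :
  \det (gl_matrix c) * c gl_last = 1 ->
  gl_matrix c \in unitmx /\ gl_coord (gl_matrix c) =1 c.
Proof.
move=> dc; split.
  rewrite unitmxE unitfE; apply: contra_eq_neq dc => ->.
  by rewrite mul0r eq_sym oner_neq0.
apply: gl_indexP => [i j|]; first by rewrite gl_coordE mxE.
by rewrite gl_coord_last; apply: mulr1_eq.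
Qed.

Lemma gl_coord_det (K : fieldType) (g : 'M[K]_n) : g \in unitmx ->
  \det (gl_matrix (gl_coord g)) * gl_coord g gl_last = 1.
Proof.
by rewrite unitmxE unitfE => d0; rewrite gl_coordK gl_coord_last divff.
Qed.

Section GenericMatrix.
Variable K : fieldType.
Let N := (n * n + 1)%N.

Definition generic_mx : 'M[{mpoly K[N]}]_n := gl_matrix (fun k => 'X_k).

Lemma generic_mx_eval (c : 'I_N -> K) : map_mx (meval c) generic_mx = gl_matrix c.
Proof. by apply/matrixP => i j; rewrite !mxE mevalXU. Qed.

(** Cramer's rule, with ['X_gl_last] in the place of the inverse determinant. *)
Definition generic_inv_coord (k : 'I_N) : {mpoly K[N]} :=
  row_mx (mxvec ('X_gl_last *: \adj generic_mx)) (\det generic_mx)%:M 0 k.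

Lemma generic_inv_coordE (g : 'M[K]_n) k : g \in unitmx ->
  (generic_inv_coord k).@[gl_coord g] = gl_coord (invmx g) k.
Proof.
move=> ug; move: k; apply: gl_indexP => [i j|].
  rewrite gl_coordE /generic_inv_coord row_mxEl mxvecE mxE mevalM mevalXU gl_coord_last.
  rewrite /invmx ug [RHS]mxE; congr (_ * _).
  transitivity (map_mx (meval (gl_coord g)) (\adj generic_mx) i j).
    by rewrite [RHS]mxE.
  by rewrite map_mx_adj generic_mx_eval gl_coordK.
rewrite gl_coord_last /generic_inv_coord row_mxEr mxE -det_map_mx generic_mx_eval.
by rewrite gl_coordK det_inv invrK.
Qed.

End GenericMatrix.
End GLCoordinates.

Section VanishingIdeal.
Variables (C : numClosedFieldType) (n : nat) (G : linear_algebraic_group C n).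
Local Notation N := (n * n + 1)%N.

Definition vanishing (p : {mpoly C[N]}) := forall g, G g -> p.@[gl_coord g] = 0.

Lemma vanishing_ideal : ideal vanishing.
Proof.
split=> [g _|p q Ip Iq g Gg|p q Iq g Gg]; first by rewrite meval0.
  by rewrite mevalD Ip // Iq // addr0.
by rewrite mevalM Iq // mulr0.
Qed.

Lemma lag_unit g : G g -> g \in unitmx.
Proof. by have [S ->] := lag_closed G; case. Qed.

(** The polynomial [D] vanishes on the group and makes the last coordinate of [c] the inverse
    determinant, so [c] comes from an invertible matrix. *)
Lemma vanishing_zero (c : 'I_N -> C) : (forall p, vanishing p -> p.@[c] = 0) ->
  exists2 g, G g & gl_coord g =1 c.
Proof.
move=> c0; pose D := \det (generic_mx n C) * 'X_(gl_last n) - 1.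
have DE (c' : 'I_N -> C) : D.@[c'] = \det (gl_matrix c') * c' (gl_last n) - 1.
  by rewrite /D mevalB meval1 mevalM mevalXU -det_map_mx generic_mx_eval.
have [] := @gl_matrixK _ _ c.
  apply/eqP; rewrite -subr_eq0 -DE; apply/eqP/c0 => g /lag_unit ug.
  by rewrite DE gl_coord_det // subrr.
move=> ug gE; exists (gl_matrix c); last exact: gE.
have [S GE] := lag_closed G; rewrite GE; split=> // p Sp.
rewrite (meval_eq _ gE); apply: c0 => g; rewrite GE => -[_]; exact.
Qed.

Lemma arc_vanishing rho p : Defs.arc G rho -> vanishing p ->
  mmap (@laurent_const C) (gl_coord rho) p = 0.
Proof. by move=> [_ rho0] Ip; rewrite -map_mpoly_eval; apply: rho0. Qed.

Lemma represents_coord (V : vectType C) (rV : algebraic_rep G V) m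
    (X : m.-tuple V) i x : exists p, represents G (fun g => coord X i (rV g x)) p.
Proof.
have [p pP] := rep_regular rV (linfun (coord X i : V -> C^o)) x.
by exists p => g Gg; rewrite -pP // lfunE.
Qed.

Lemma rep_inv (V : vectType C) (rV : algebraic_rep G V) g x : G g ->
  rV (invmx g) (rV g x) = x.
Proof.
move=> Gg; have := rep_actM rV (lagV Gg) Gg; rewrite mulVmx ?lag_unit // rep_act1.
by move=> /lfunP /(_ x); rewrite comp_lfunE id_lfunE.
Qed.

End VanishingIdeal.

Section LaurentOrder.
Variable C : numClosedFieldType.
Local Notation L := (laurent C).
Local Notation z := (fps_z C).

Lemma laurent_z_neq0 : z%:F != 0 :> L.
Proof. by rewrite tofrac_eq0 -[z]expr1 fps_zX_neq0. Qed.

Lemma laurent_ordM (x y : L) : x != 0 -> y != 0 ->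
  laurent_ord (x * y) = laurent_ord x + laurent_ord y.
Proof.
have [a [b [b0 ->]]] := fracP x; have [c [d [d0 ->]]] := fracP y => x0 y0.
have a0 : a != 0 by apply: contraNneq x0 => ->; rewrite tofrac0 mul0r.
have c0 : c != 0 by apply: contraNneq y0 => ->; rewrite tofrac0 mul0r.
rewrite mulf_div -!tofracM !laurent_ord_frac ?mulf_neq0 // !fps_ordM //.
by rewrite !PoszD opprD addrACA.
Qed.

Lemma laurent_ord_fps (a : fps C) : a != 0 -> laurent_ord a%:F = (fps_ord a)%:Z.
Proof.
move=> a0; have := laurent_ord_frac a0 (oner_neq0 (fps C)).
rewrite tofrac1 divr1 => ->.
have -> : fps_ord (1 : fps C) = 0%N by apply: fps_ord_unique => //=; apply: oner_neq0.
by rewrite subr0.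
Qed.

Lemma fps_ord_gt0 (a : fps C) : a != 0 -> fps_ct a = 0 -> (0 < fps_ord a)%N.
Proof.
move=> /fps_ordP[ao _] a0; rewrite lt0n; apply: contraNneq ao => ->.
by rewrite -a0.
Qed.

(** Conditions on the order are restricted to [x != 0], as the order of zero is a junk value. *)
Lemma laurent_shift (m : int) (x : L) : (x != 0 -> m <= laurent_ord x) ->
  exists f, [/\ x = z%:F ^ m * f%:F, (x != 0 -> m < laurent_ord x) -> fps_ct f = 0 &
    x != 0 -> laurent_ord x = m -> fps_ct f != 0].
Proof.
have [->|x0] := eqVneq x 0.
  by move=> _; exists 0; rewrite tofrac0 mulr0; split=> // _; rewrite rmorph0.
move=> /(_ isT) le; have [u u0 xE] := laurent_factor x0.
have [k kE] : exists k : nat, laurent_ord x = m + k%:Z.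
  by exists `|laurent_ord x - m|%N; rewrite gez0_abs ?subr_ge0 // addrCA subrr addr0.
exists (z ^+ k * u); split.
- by rewrite {1}xE kE expfzDr ?laurent_z_neq0 // -exprnP tofracM tofracXn mulrA.
- move=> /(_ isT); rewrite kE ltrDl; case: k {kE} => // k _.
  by rewrite exprS -mulrA rmorphM; apply: mul0r.
- move=> _; rewrite kE => /eqP; rewrite -subr_eq0 addrC addKr; case: k {kE} => // _.
  by rewrite mul1r.
Qed.

End LaurentOrder.

(** * Semistable pairs are numerically semistable *)

Section SemistablePairs.
Variables (C : numClosedFieldType) (n : nat) (G : linear_algebraic_group C n).
Variables (V W : vectType C) (rV : algebraic_rep G V) (rW : algebraic_rep G W).
Variables (p q : nat) (X : p.-tuple V) (Y : q.-tuple W).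
Hypotheses (hX : basis_of fullv X) (hY : basis_of fullv Y).
Variables (v : V) (w : W).
Local Notation N := (n * n + 1)%N.
Local Notation L := (laurent C).
Local Notation z := (fps_z C).

Lemma vcoordD (x y : V * W) k : vcoord (x + y) k = vcoord x k + vcoord y k.
Proof. exact: linearD. Qed.

Lemma vcoordZ c (x : V * W) k : vcoord (c *: x) k = c * vcoord x k.
Proof. exact: linearZ. Qed.

Lemma vcoord_pair (x : V) (y : W) k : vcoord (x, y) k =
  \sum_i coord X i x * vcoord (X`_i, 0 : W) k +
  \sum_j coord Y j y * vcoord (0 : V, Y`_j) k.
Proof.
have vsum (I : finType) (f : I -> V * W) :
    vcoord (\sum_i f i) k = \sum_i vcoord (f i) k by exact: linear_sum.
have -> : (x, y) = \sum_i coord X i x *: (X`_i, 0 : W) +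
    \sum_j coord Y j y *: (0 : V, Y`_j).
  have sumV (I : finType) (c : I -> C) (f : I -> V) :
      \sum_i c i *: (f i, 0 : W) = (\sum_i c i *: f i, 0).
    elim/big_rec2: _ => // i a b _ ->; congr (_, _) => /=.
    by rewrite scaler0 addr0.
  have sumW (I : finType) (c : I -> C) (f : I -> W) :
      \sum_i c i *: (0 : V, f i) = (0, \sum_i c i *: f i).
    elim/big_rec2: _ => // i a b _ ->; congr (_, _) => /=.
    by rewrite scaler0 addr0.
  rewrite sumV sumW; congr (_, _) => /=.
    by rewrite addr0 -(coord_basis hX) ?memvf.
  by rewrite add0r -(coord_basis hY) ?memvf.
rewrite vcoordD !vsum; congr (_ + _); apply: eq_bigr => i _; exact: vcoordZ.
Qed.

Lemma dim_line_vline (u : V * W) : u != 0 -> \dim <[u]>%VS = 1%N.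
Proof. by move=> u0; rewrite dim_vline u0. Qed.

(** From [w = g^-1 (g w)], each coordinate of [w] is a combination of those of [g w] with
    coefficients regular on the group. The identity passes to arcs, so the [b j] cannot all be zero
    there and their least order is not the junk value. *)
Lemma arc_eval_w_neq0 rho : w != 0 -> Defs.arc G rho ->
  exists j, arc_eval G (fun g => coord Y j (rW g w)) rho != 0.
Proof.
move=> w0 rhoG; apply/existsP; apply: contraNT w0; rewrite negb_exists => /forallP b0.
apply/eqP; rewrite [w](coord_basis hY) ?memvf //; apply: big1 => i _.
have /choice[pb pbP] j := represents_coord rW Y j w.
have /choice[qq qqP] j := represents_coord rW Y i Y`_j.
pose pinv j := mmap (@mpolyC N C) (@generic_inv_coord n C) (qq j).
pose D := \sum_j pb j * pinv j - (coord Y i w)%:MP.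
have pinvE j g : G g -> (pinv j).@[gl_coord g] = coord Y i (rW (invmx g) Y`_j).
  move=> Gg; rewrite (qqP j _ (lagV Gg)) /pinv (@meval_mmap _ _ _ _ idfun).
  by apply: eq_mmap => // k; rewrite generic_inv_coordE // (lag_unit Gg).
have ID : vanishing G D.
  move=> g Gg; rewrite /D mevalB mevalC rmorph_sum /=.
  apply/eqP; rewrite subr_eq0; apply/eqP.
  rewrite -[in RHS](rep_inv rW w Gg).
  rewrite [rW g w](coord_basis hY) ?memvf // !linear_sum; apply: eq_bigr => j _.
  by rewrite mevalM pinvE // -(pbP j) // !linearZ.
have := arc_vanishing rhoG ID.
rewrite rmorphB rmorph_sum big1 => [|j _].
  rewrite sub0r /= mmapC => /eqP; rewrite oppr_eq0 fmorph_eq0 => /eqP ->.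
  by rewrite scale0r.
have := b0 j; rewrite negbK => /eqP; rewrite (arc_evalE (pbP j) rhoG) map_mpoly_eval =>
  bj0.
by rewrite rmorphM /= bj0 mul0r.
Qed.

Lemma semistable_numerically_semistable : w != 0 ->
  semistable rV rW v w -> numerically_semistable rV rW X Y v w.
Proof.
move=> w0 ss rho rhoG; rewrite leNgt; apply/negP; rewrite subr_lt0.
have /choice[pa paP] i := represents_coord rV X i v.
have /choice[pb pbP] j := represents_coord rW Y j w.
pose b j := arc_eval G (fun g => coord Y j (rW g w)) rho.
pose a i := arc_eval G (fun g => coord X i (rV g v)) rho.
rewrite -/a -/b => lt_ba; set m := min_ord b in lt_ba.
have bE j : b j = mmap (@laurent_const C) (gl_coord rho) (pb j).
  by rewrite /b (arc_evalE (pbP j) rhoG) map_mpoly_eval.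
have aE i : a i = mmap (@laurent_const C) (gl_coord rho) (pa i).
  by rewrite /a (arc_evalE (paP i) rhoG) map_mpoly_eval.
have [j0 bj0] := arc_eval_w_neq0 w0 rhoG.
have [[j1 bj1 mE] m_min] := min_ordP (c := b) bj0.
have /choice[be beP] j := laurent_shift (m_min j).
have lt_a i : a i != 0 -> m < laurent_ord (a i).
  by move=> ai0; have [_ /(_ i ai0)] := min_ordP (c := a) ai0; apply: lt_le_trans.
have /choice[al alP] i := laurent_shift (fun ai0 => ltW (lt_a i ai0)).
(* The limit of the arc: its coordinates divided by [z ^ m], at [z = 0], are those of [(0, wb)]. It
   is non-zero because [m] is attained. *)
pose wb := \sum_j fps_ct (be j) *: Y`_j.
have wb0 : wb != 0.
  have [_ _ /(_ bj1 (esym mE))] := beP j1; apply: contra_neq => wb0.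
  have := coord_sum_free (fun j => fps_ct (be j)) j1 (basis_free hY).
  by rewrite -/wb wb0 linear0.
have u0 : (0 : V, wb) != 0 by apply: contra_neq wb0 => -[].
pose L0 := Proj (dim_line_vline u0).
suff : (proj_closure (pair_orbit rV rW v w) `&` @proj_snd C V W)%classic L0 by rewrite ss.
split; last by move=> _ /vlineP[c ->] /=; rewrite scaler0.
move=> Z [S homS ->] orbS P SP; have [d homP] := homS P SP.
move=> _ /vlineP[c ->].
have -> : P.@[vcoord (c *: (0 : V, wb))] = c ^+ d * P.@[vcoord (0 : V, wb)].
  rewrite ![meval _ _]/(mmap idfun _ _) -(mmap_homog_scale _ _ _ homP).
  by apply: eq_mmap => // k; rewrite vcoordZ.
suff -> : P.@[vcoord (0 : V, wb)] = 0 by rewrite mulr0.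
pose ka (i : 'I_p) k : C := vcoord (X`_i, 0 : W) k.
pose kb (j : 'I_q) k : C := vcoord (0 : V, Y`_j) k.
(* The orbit map in the fixed basis of [V * W] that defines closed sets; [P] composed with it lies
   in the ideal of the group. *)
pose ell k := \sum_i ka i k *: pa i + \sum_j kb j k *: pb j.
have IP : vanishing G (mmap (@mpolyC N C) ell P).
  move=> g Gg; rewrite (@meval_mmap _ _ _ _ idfun).
  have gvw0 : (rV g v, rW g w) != 0.
    apply: contra_neq w0 => -[_ gw0].
    by rewrite -(rep_inv rW w Gg) gw0 linear0.
  have orb : pair_orbit rV rW v w (Proj (dim_line_vline gvw0)) by exists g.
  rewrite -(orbS _ orb P SP _ (memv_line _)) [RHS]/(mmap idfun _ _).
  apply: eq_mmap => // k; rewrite vcoord_pair mevalD !rmorph_sum.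
  by congr (_ + _); apply: eq_bigr => i _; rewrite /= mevalZ mulrC -?paP -?pbP.
pose ga k := \sum_i fps_const (ka i k) * al i + \sum_j fps_const (kb j k) * be j.
have zm0 : z%:F ^ m != 0 :> L := expfz_neq0 m (laurent_z_neq0 C).
have ellE k : mmap (@laurent_const C) (gl_coord rho) (ell k) = z%:F ^ m * (ga k)%:F.
  rewrite !(rmorphD, rmorph_sum) mulrDr !mulr_sumr /=.
  congr (_ + _); apply: eq_bigr => i _; rewrite mmapZ rmorphM /= mulrCA.
    by have [<- _ _] := alP i; rewrite aE.
  by have [<- _ _] := beP i; rewrite bE.
(* By homogeneity a power of [z ^ m] factors out of the value of [P] on the arc; the remaining
   factor vanishes and can be reduced modulo [z]. *)
have : mmap (@fps_const C) ga P = 0.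
  have /eqP := arc_vanishing rhoG IP.
  have -> : mmap (@laurent_const C) (gl_coord rho) (mmap (@mpolyC N C) ell P) =
      mmap (@FracField.tofrac _ \o @fps_const C)
        (fun k => z%:F ^ m * (@FracField.tofrac (fps C) \o ga) k) P.
    rewrite mmap_rmorph; apply: eq_mmap => [b'|k]; last exact: ellE.
    by rewrite /= mmapC.
  rewrite (mmap_homog_scale _ _ _ homP) mulf_eq0 expf_eq0 (negPf zm0) andbF /=.
  by rewrite -mmap_rmorph tofrac_eq0 => /eqP.
move=> /(congr1 (@fps_ct C)); rewrite mmap_rmorph rmorph0 => ga0; rewrite -ga0.
rewrite [LHS]/(mmap idfun _ _); apply: eq_mmap => // k.
rewrite -[RHS]/(fps_ct (ga k)) rmorphD !rmorph_sum vcoord_pair.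
have ctM (c' : C) (f : fps C) : fps_ct (fps_const c' * f) = c' * fps_ct f.
  by rewrite rmorphM.
congr (_ + _); apply: eq_bigr => i _.
  transitivity (ka i k * fps_ct (al i)); last exact: esym (ctM _ _).
  have [_ -> //] := alP i; last exact: lt_a.
  by rewrite linear0 mul0r mulr0.
transitivity (kb i k * fps_ct (be i)); last exact: esym (ctM _ _).
rewrite mulrC; congr (_ * _).
exact: coord_sum_free (basis_free hY).
Qed.

End SemistablePairs.

(** * Numerically semistable pairs are semistable *)

Section Homogenization.
Variables (F : comNzRingType) (p q : nat) (j0 : 'I_q).

(** The degree [msize P] is one above that of a non-zero [P]; the extra factor is harmless where the
    homogenising variable is non-zero. *)
Definition homogenize (P : {mpoly F[p]}) : {mpoly F[p + q]} :=
  \sum_(d < msize P) mmap (@mpolyC _ F \o idfun) (fun i => 'X_(lshift q i))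
    (pihomog mdeg d P) * 'X_(rshift p j0) ^+ (msize P - d).

Lemma dhomog_XU n i : ('X_i : {mpoly F[n]}) \is 1.-homog.
Proof. by rewrite dhomogX /= mdeg1. Qed.

Lemma homogenize_homog P : homogenize P \is (msize P).-homog.
Proof.
rewrite /homogenize; apply: rpred_sum => d _.
have hX : ('X_(rshift p j0) : {mpoly F[p + q]}) ^+ (msize P - d) \is (msize P - d).-homog.
  by have := dhomogMn (msize P - d) (dhomog_XU (rshift p j0)); rewrite mul1n.
have hP : mmap (@mpolyC _ F \o idfun) (fun i => 'X_(lshift q i)) (pihomog mdeg d P)
    \is (d : nat).-homog.
  by apply: dhomog_subst (pihomogP _ _ _) => i; apply: dhomog_XU.
by have := dhomogM hP hX; rewrite subnKC // ltnW.
Qed.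

Lemma homogenize_eval (S : comNzRingType) (f : {rmorphism F -> S})
    (c : 'I_(p + q) -> S) (x : 'I_p -> S) P :
  (forall i, c (lshift q i) = c (rshift p j0) * x i) ->
  mmap f c (homogenize P) = c (rshift p j0) ^+ msize P * mmap f x P.
Proof.
move=> cx; rewrite /homogenize rmorph_sum.
rewrite [X in _ * mmap f x X](pihomog_partitionE (mf := mdeg) (leqnn (msize P))).
rewrite rmorph_sum mulr_sumr.
apply: eq_bigr => d _; rewrite rmorphM rmorphXn /= mmap_XU.
have -> : mmap f c (mmap (@mpolyC _ F \o idfun) (fun i => 'X_(lshift q i)) (pihomog
  mdeg d P)) =
    mmap f (fun i => c (rshift p j0) * x i) (pihomog mdeg d P).
  rewrite mmap_rmorph; apply: eq_mmap => [b|i] /=; first by rewrite mmapC.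
  by rewrite mmap_XU cx.
rewrite (mmap_homog_scale _ _ _ (pihomogP mdeg d P)) mulrAC -exprD subnKC //.
exact: ltnW (ltn_ord d).
Qed.

End Homogenization.

Section NumericallySemistable.
Variables (C : numClosedFieldType) (n : nat) (G : linear_algebraic_group C n).
Variables (V W : vectType C) (rV : algebraic_rep G V) (rW : algebraic_rep G W).
Variables (p q : nat) (X : p.-tuple V) (Y : q.-tuple W).
Hypotheses (hX : basis_of fullv X) (hY : basis_of fullv Y).
Variables (v : V) (w : W).
Hypothesis uncC : uncountable C.
Local Notation N := (n * n + 1)%N.
Local Notation L := (laurent C).

Definition pair_coord (x : V) (y : W) (k : 'I_(p + q)) : C :=
  match fintype.split k with inl i => coord X i x | inr j => coord Y j y end.

(** Coordinates along [X] and [Y] are linear forms in those of the fixed basis of [V * W], so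
    substitution turns [P] into one of the equations that define the closure. *)
Lemma closure_relation (L0 : proj (V * W)%type) (u : V * W) (P : {mpoly C[p + q]}) d :
    proj_closure (pair_orbit rV rW v w) L0 -> u \in line L0 -> P \is d.-homog ->
    (forall g, G g -> P.@[pair_coord (rV g v) (rW g w)] = 0) ->
  P.@[pair_coord u.1 u.2] = 0.
Proof.
move=> clL0 uL0 homP P0.
pose e k : V * W := (vbasis {: (V * W)%type})`_k.
pose ell k := \sum_(l < \dim {: (V * W)%type}) pair_coord (e l).1 (e l).2 k *: ('X_l :
  {mpoly C[_]}).
pose Q := mmap (@mpolyC _ C \o idfun) ell P.
have QE x : Q.@[vcoord x] = P.@[pair_coord x.1 x.2].
  rewrite /Q meval_mmap [RHS]/(mmap idfun _ _); apply: eq_mmap => // k.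
  rewrite /ell rmorph_sum /=.
  have xE : x = \sum_l vcoord x l *: e l by apply: coord_vbasis; rewrite memvf.
  have x1 : x.1 = \sum_l vcoord x l *: (e l).1.
    rewrite {1}xE; elim/big_rec2: _ => //= l a b _ <-; by [].
  have x2 : x.2 = \sum_l vcoord x l *: (e l).2.
    rewrite {1}xE; elim/big_rec2: _ => //= l a b _ <-; by [].
  rewrite /pair_coord; case: (fintype.split k) => i.
    rewrite x1 linear_sum; apply: eq_bigr => l _.
    by rewrite mevalZ mevalXU linearZ mulrC.
  rewrite x2 linear_sum; apply: eq_bigr => l _.
  by rewrite mevalZ mevalXU linearZ mulrC.
have homQ : Q \is d.-homog.
  apply: dhomog_subst homP => k; apply: rpred_sum => l _; apply: rpredZ.
  exact: dhomog_XU.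
have QL0 : proj_zeros [set Q]%classic L0.
  apply: clL0; first by exists [set Q]%classic => // _ ->; exists d.
  move=> K [g Gg KE] _ -> x; rewrite KE => /vlineP[c ->].
  rewrite QE [LHS]/(mmap idfun _ _).
  transitivity (mmap idfun (fun k => c * pair_coord (rV g v) (rW g w) k) P).
    apply: eq_mmap => // k; rewrite /pair_coord /=.
    by case: (fintype.split k) => i; rewrite linearZ.
  by rewrite (mmap_homog_scale _ _ _ homP) [mmap _ _ _]P0 // mulr0.
by rewrite -QE; apply: QL0.
Qed.

Lemma destabilizing_arc (L0 : proj (V * W)%type) (u : V * W) :
    v != 0 -> proj_closure (pair_orbit rV rW v w) L0 -> u \in line L0 ->
    u.1 = 0 -> u.2 != 0 ->
  exists2 rho, Defs.arc G rho & arc_weight rV rW X Y rho v w < 0.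
Proof.
move=> v0 clL0 uL0 u10 u20.
have /choice[pa paP] i := represents_coord rV X i v.
have /choice[pb pbP] j := represents_coord rW Y j w.
have [idI0 idID idIM] := vanishing_ideal G.
have IZ c p' : vanishing G p' -> vanishing G (c *: p').
  by rewrite -mul_mpolyC; apply: idIM.
have [e [Ie espan]] := countable_spanning idI0 idID IZ.
(* The entry [0] accounts for monomials outside the support. *)
pose coefs (p' : {mpoly C[N]}) : seq C := 0 :: [seq p'@_m | m <- msupp p'].
have coefsP p' m : p'@_m \in coefs p'.
  rewrite inE; have [mp|/memN_msupp_eq0->] := boolP (m \in msupp p'); last by rewrite
    eqxx.
  by apply/orP; right; apply: map_f.
pose om j := coord Y j u.2.
pose consts := flatten [seq coefs (pa i) | i <- enum 'I_p] ++
  flatten [seq coefs (pb j) | j <- enum 'I_q] ++ [seq om j | j <- enum 'I_q].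
have [F [io [enumF ioP]]] := countable_subfield (fun k => consts ++ coefs (e k)).
have ioc x : x \in consts -> exists y, io y = x.
  by move=> xc; apply: (ioP 0%N); rewrite mem_cat xc.
have /choice[e0 e0E] k : exists p0, map_mpoly io p0 = e k.
  by apply: mpoly_descent => m; apply: (ioP k); rewrite mem_cat coefsP orbT.
have /choice[pa0 pa0E] i : exists p0, map_mpoly io p0 = pa i.
  apply: mpoly_descent => m; apply: ioc; rewrite !mem_cat; apply/orP; left.
  apply/flattenP; exists (coefs (pa i)); rewrite ?coefsP //.
  by apply/mapP; exists i; rewrite ?mem_enum.
have /choice[pb0 pb0E] j : exists p0, map_mpoly io p0 = pb j.
  apply: mpoly_descent => m; apply: ioc; rewrite !mem_cat; apply/orP; right.
  apply/orP; left.
  apply/flattenP; exists (coefs (pb j)); rewrite ?coefsP //.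
  by apply/mapP; exists j; rewrite ?mem_enum.
have /choice[om0 om0E] j : exists x, io x = om j.
  by apply: ioc; rewrite !mem_cat map_f ?mem_enum ?orbT.
pose pab k := match fintype.split k with inl i => pa i | inr j => pb j end.
pose pt : 'I_(p + q) -> F := fun k =>
  match fintype.split k with inl _ => 0 | inr j => om0 j end.
pose sub : {rmorphism {mpoly F[p + q]} -> {mpoly C[N]}} := mmap (@mpolyC N C \o io) pab.
have subE P g : G g -> (sub P).@[gl_coord g] = mmap io (pair_coord (rV g v) (rW g w)) P.
  move=> Gg; rewrite /sub /= meval_mmap; apply: eq_mmap => // k.
  by rewrite /pab /pair_coord; case: (fintype.split k) => i; rewrite -?paP -?pbP.
(* As [pt] represents a point of the closure, none of these polynomials vanishes on the whole orbit.
   They are closed under products, so one element of the group can avoid the zeros of all of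
   them. *)
pose good (P : {mpoly F[p + q]}) := `[< exists d, P \is d.-homog >] && (P.@[pt] != 0).
have good1 : good 1.
  by rewrite /good meval1 oner_neq0 andbT; apply/asboolP; exists 0%N; apply: dhomog1.
have goodM P Q : good P -> good Q -> good (P * Q).
  move=> /andP[/asboolP[d hP] P0] /andP[/asboolP[d' hQ] Q0].
  rewrite /good mevalM mulf_neq0 // andbT; apply/asboolP; exists (d + d')%N.
  exact: dhomogM.
have good_nonvanishing P : good P -> ~ vanishing G (sub P).
  move=> /andP[/asboolP[d hP] P0] IP; case/negP: P0; rewrite -(fmorph_eq0 io).
  have hP' : map_mpoly io P \is d.-homog.
    apply/dhomogP => m; rewrite mcoeff_msupp mcoeff_map_mpoly fmorph_eq0 -mcoeff_msupp.
    by move: m; apply/dhomogP.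
  have := closure_relation clL0 uL0 hP'; rewrite map_mpoly_eval => <-; last first.
    by move=> g Gg; rewrite map_mpoly_eval -subE // IP.
  rewrite [meval _ _]/(mmap idfun _ _) mmap_rmorph; apply/eqP; apply: eq_mmap => // k.
  rewrite /pair_coord /pt /=; case: (fintype.split k) => i; last by rewrite om0E.
  by rewrite rmorph0 u10 linear0.
have [en enP] := enumerable_mpoly (p + q) enumF.
pose S k := if good (en k) then sub (en k) else 1.
have S_good P : good P -> exists k, S k = sub P.
  by move=> gP; have [k kE] := enP P; exists k; rewrite /S kE gP.
have good_S k : exists2 P, good P & S k = sub P.
  rewrite /S; case: ifP => [gk|_]; first by exists (en k).
  by exists 1; rewrite ?rmorph1.
have S1 : exists k, S k = 1 by have [k kE] := S_good 1 good1; exists k; rewrite kE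
  rmorph1.
have SM i j : exists k, S k = S i * S j.
  have [P gP ->] := good_S i; have [Q gQ ->] := good_S j.
  have [k kE] := S_good _ (goodM P Q gP gQ).
  by exists k; rewrite kE rmorphM.
have avS : avoids S (vanishing G).
  by move=> k; have [P gP ->] := good_S k; apply: good_nonvanishing.
have [c [c0 Sc]] := countable_nullstellensatz uncC S1 SM (vanishing_ideal G) avS.
have [g Gg gc] := vanishing_zero c0.
have generic P : good P -> mmap io (pair_coord (rV g v) (rW g w)) P != 0.
  move=> gP; rewrite -subE // (meval_eq _ gc).
  by have [k <-] := S_good P gP; apply: Sc.
(* The coordinate form of index [j0] is then [good], so [b j0] is non-zero and can serve as
   denominator. *)
have [j0 omj0] : exists j, om0 j != 0.
  apply/existsP; apply: contraNT u20; rewrite negb_exists => /forallP z0.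
  rewrite [u.2](coord_basis hY) ?memvf // big1 // => j _.
  by have := z0 j; rewrite negbK => /eqP z1; rewrite -/(om j) -om0E z1 rmorph0 scale0r.
pose a i := coord X i (rV g v); pose b j := coord Y j (rW g w).
have pcl i : pair_coord (rV g v) (rW g w) (lshift q i) = a i.
  by rewrite /pair_coord (unsplitK (inl _ i)).
have pcr j : pair_coord (rV g v) (rW g w) (rshift p j) = b j.
  by rewrite /pair_coord (unsplitK (inr _ j)).
have ptl i : pt (lshift q i) = 0 by rewrite /pt (unsplitK (inl _ i)).
have ptr j : pt (rshift p j) = om0 j by rewrite /pt (unsplitK (inr _ j)).
have bj0 : b j0 != 0.
  have := generic 'X_(rshift p j0); rewrite mmap_XU pcr; apply.
  rewrite /good mevalXU ptr omj0 andbT; apply/asboolP; exists 1%N.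
  exact: dhomog_XU.
pose x i := a i / b j0.
(* If [P] had a constant term, its homogenisation would be non-zero at [pt], hence [good], and could
   not vanish at the generic point. *)
have x0 P : mmap io x P = 0 -> P.@[fun _ => 0] = 0.
  move=> Px; apply/eqP; apply: contraPT Px => P0; apply/eqP.
  have := generic (homogenize j0 P).
  rewrite (@homogenize_eval _ _ _ j0 _ _ _ x) => [|i]; last first.
    by rewrite pcl pcr /x mulrC divfK.
  rewrite mulf_eq0 negb_or => H; apply: (proj2 (andP (H _))).
  apply/andP; split; first by apply/asboolP; exists (msize P); apply: homogenize_homog.
  rewrite -[X in X != 0]/(mmap idfun pt (homogenize j0 P)) (@homogenize_eval _ _ _ j0 _
    _ _ (fun _ => 0)) => [|i].
    by rewrite ptr mulf_neq0 // expf_neq0.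
  by rewrite ptl mulr0.
have [Q [Qts Qx]] := generic_place enumF uncC (codom (gl_coord g)) x0.
have /choice[th thE] k : exists t, pl_in Q t = gl_coord g k.
  by apply: Qts; apply: codom_f.
(* The coordinates of [g], lifted to the place and carried to [C((z))]; the equation between
   determinant and last coordinate is inherited from [g]. *)
pose rho := gl_matrix (pl_out Q \o th).
have [rhoU rhoE] : rho \in unitmx /\ gl_coord rho =1 pl_out Q \o th.
  apply: gl_matrixK; rewrite gl_matrix_map det_map_mx /= -rmorphM.
  rewrite -[RHS](rmorph1 (pl_out Q)); congr (pl_out Q _); apply: (fmorph_inj (pl_in Q)).
  rewrite rmorphM rmorph1 -det_map_mx -gl_matrix_map thE.
  rewrite -[RHS](gl_coord_det (lag_unit Gg)); congr (\det _ * _).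
  by apply/matrixP => i j; rewrite !mxE /= thE.
pose el (p0 : {mpoly F[N]}) : Q := mmap (pl_base Q) th p0.
have el_in p0 : pl_in Q (el p0) = (map_mpoly io p0).@[gl_coord g].
  rewrite /el mmap_rmorph map_mpoly_eval; apply: eq_mmap => [y|k] /=.
    by rewrite pl_in_base.
  by rewrite thE.
have el_out p0 : pl_out Q (el p0) = mmap (@laurent_const C) (gl_coord rho) (map_mpoly
  io p0).
  rewrite /el mmap_rmorph [map_mpoly _ _]/(mmap _ _ _) mmap_rmorph.
  apply: eq_mmap => [y|k] /=; first by rewrite pl_out_base mmapC.
  by rewrite mmap_XU rhoE.
(* It suffices to test the spanning family, whose members have coefficients in [F] and vanish at
   [g]. *)
have rhoG : Defs.arc G rho.
  split=> // p' Ip'; rewrite map_mpoly_eval; have [s ->] := espan p' Ip'.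
  rewrite rmorph_sum big1 // => y _; rewrite /= mmapZ -e0E -el_out.
  have -> : el (e0 y.2) = 0; last by rewrite rmorph0 mulr0.
  by apply: (fmorph_inj (pl_in Q)); rewrite el_in e0E rmorph0 Ie.
exists rho => //.
pose al i := el (pa0 i); pose be j := el (pb0 j).
have al_in i : pl_in Q (al i) = a i by rewrite el_in pa0E -paP.
have be_in j : pl_in Q (be j) = b j by rewrite el_in pb0E -pbP.
have al_out i : arc_eval G (fun g => coord X i (rV g v)) rho = pl_out Q (al i).
  by rewrite (arc_evalE (paP i) rhoG) map_mpoly_eval el_out pa0E.
have be_out j : arc_eval G (fun g => coord Y j (rW g w)) rho = pl_out Q (be j).
  by rewrite (arc_evalE (pbP j) rhoG) map_mpoly_eval el_out pb0E.
have be0 : be j0 != 0 by rewrite -(fmorph_eq0 (pl_in Q)) be_in.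
have [i0 ai0] : exists i, a i != 0.
  apply/existsP; apply: contraNT v0; rewrite negb_exists => /forallP z0.
  rewrite -(rep_inv rV v Gg) [rV g v](coord_basis hX) ?memvf // big1 ?linear0 // => i _.
  by have := z0 i; rewrite negbK => /eqP z1; rewrite -/(a i) z1 scale0r.
have al0 : al i0 != 0 by rewrite -(fmorph_eq0 (pl_in Q)) al_in.
rewrite /arc_weight subr_lt0 (funext al_out) (funext be_out).
have ao : pl_out Q (al i0) != 0 by rewrite fmorph_eq0.
have bo : pl_out Q (be j0) != 0 by rewrite fmorph_eq0.
have [_ /(_ j0 bo) le_b] := min_ordP (c := fun j => pl_out Q (be j)) bo.
have [[i1 ai1 ->] _] := min_ordP (c := fun i => pl_out Q (al i)) ao.
apply: le_lt_trans le_b _.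
(* [i1] attains the least order among the [a i], and its quotient by [b j0] has positive order in
   this place; so [b j0] has smaller order than every non-zero [a i]. *)
have [|z z0 zE] := Qx i1 (al i1 / be j0); first by rewrite fmorph_div al_in be_in.
have alE : pl_out Q (al i1) = z%:F * pl_out Q (be j0) by rewrite -zE -rmorphM divfK.
have zn0 : z != 0 by apply: contraNneq ai1 => zn; rewrite alE zn tofrac0 mul0r.
rewrite alE laurent_ordM ?tofrac_eq0 // laurent_ord_fps // ltrDr.
exact: fps_ord_gt0.
Qed.

Lemma numerically_semistable_semistable : v != 0 ->
  numerically_semistable rV rW X Y v w -> semistable rV rW v w.
Proof.
move=> v0 ns; apply/seteqP; split=> // L0 [clL0 sndL0].
have L0n0 : line L0 != 0%VS by rewrite -dimv_eq0 (dim_line L0).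
have uL0 := memv_pick (line L0); set u := vpick _ in uL0.
have u0 : u != 0 by rewrite vpick0.
have u10 := sndL0 u uL0.
have u20 : u.2 != 0 by apply: contra_neq u0 => u20; case: u u10 u20 {uL0} => a b /= -> ->.
have [rho rhoG] := destabilizing_arc v0 clL0 uL0 u10 u20.
by rewrite ltNge ns.
Qed.

End NumericallySemistable.

Theorem theorem3p10 (R : realType) (n : nat)
  (G : linear_algebraic_group R[i] n) (V W : vectType R[i])
  (rV : algebraic_rep G V) (rW : algebraic_rep G W)
  (p q : nat) (X : p.-tuple V) (Y : q.-tuple W)
  (hX : basis_of fullv X) (hY : basis_of fullv Y)
  (v : V) (w : W) (hv : v != 0) (hw : w != 0) :
  semistable rV rW v w <-> numerically_semistable rV rW X Y v w.
Proof.
split; first exact: semistable_numerically_semistable.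
by apply: numerically_semistable_semistable hv => //; apply: complex_uncountable.
Qed.
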